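(* Consider the reduced power flow equation $$\mathbf 0_n=Q_L(E_L)+[E_L]B_{\rm red}(E_L-E_L^* )$$ with the dynamic shunt load model, i.e. with $Q_L(E_L)=[E_L]^2b$, where the shunt susceptances $b\in\mathbb{R}^n$ evolve according to $$T\dot b=Q_L-[E_L]^2b,$$ $T\in\mathbb{R}^{n\times n}$ being a diagonal matrix of positive time constants and $Q_L=(Q_1,\dots,Q_n)\in\mathbb{R}^n$ a constant vector with $Q_i<0$ for all $i\in\mathcal L$. If $\|Q_L\|$ is sufficiently small, then there exists a unique solution $(E_L^{\rm DS},b^{\rm DS})\in\mathbb{R}^n_{>0}\times\mathbb{R}^n_{<0}$ of the reduced power flow equation together with the steady-state load equation, that is, of $$\mathbf 0_n=[E_L]^2b+[E_L]B_{\rm red}(E_L-E_L^* ),\qquad \mathbf 0_n=Q_L-[E_L]^2b,$$ given by $$E_L^{\rm DS}=[E_L^*]\left(\mathbf 1_n-Q_{\rm sc}^{-1}Q_L+\epsilon\right),\qquad b^{\rm DS}=[E_L^{\rm DS}]^{-2}Q_L,$$ where $Q_{\rm sc}=[E_L^*]B_{\rm red}[E_L^*]$ and $\|\epsilon\|=\mathcal O(\|Q_{\rm sc}^{-1}Q_L\|^2)$, and the corresponding equilibrium point $(E_L^{\rm DS},E_I^{\rm DS},b^{\rm DS})$, with $E_I^{\rm DS}=W_2\begin{pmatrix}E_L^{\rm DS}\\ E_I^*\end{pmatrix}$, of the closed-loop system $$\begin{pmatrix}\mathbf 0_n\\ \tau_I\dot E_I\end{pmatrix}=\begin{pmatrix}[E_L]^2b\\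 [E_I]K_I(E_I-E_I^* )\end{pmatrix}+[E]BE,\qquad T\dot b=Q_L-[E_L]^2b,$$ is locally exponentially stable.
   Context: Network: $n,m\ge 1$ are integers, $\mathcal L=\{1,\dots,n\}$ is the set of load buses, $\mathcal I=\{n+1,\dots,n+m\}$ the set of inverter buses, and $G$ is a connected undirected weighted graph on $\mathcal L\cup\mathcal I$ with edge set $\mathcal E$. The susceptance matrix $B\in\mathbb{R}^{(n+m)\times(n+m)}$ is symmetric with $B_{ij}=B_{ji}>0$ if $\{i,j\}\in\mathcal E$, $B_{ij}=0$ for $i\neq j$ with $\{i,j\}\notin\mathcal E$, and $B_{ii}=-\sum_{j\ne i}B_{ij}$. For a vector $x$, $[x]$ is the diagonal matrix with $x$ on the diagonal; $\mathbf 0_n$ and $\mathbf 1_n$ are the vectors of zeros and ones. Block partition according to loads and inverters: $E=(E_L,E_I)$ is the vector of bus voltage magnitudes (restricted to positive values) and $B=\begin{pmatrix}B_{LL}&B_{LI}\\ B_{IL}&B_{II}\end{pmatrix}$. The diagonal matrix $K_I=\mathrm{diag}(K_i)_{i\in\mathcal I}$ contains the quadratic droop controller gains $K_i<0$, $\tau_I=\mathrm{diag}(\tau_i)_{i\in\mathcal I}$ the inverter time constants $\tau_i>0$, and $E_I^*=(E_i^* )_{i\in\mathcal I}\in\mathbb{R}^m_{>0}$ the inverter voltage set points. Define $$B_{\rm red}=B_{LL}-B_{LI}(B_{II}+K_I)^{-1}B_{IL},\qquad W_1=-B_{\rm red}^{-1}B_{LI}(B_{II}+K_I)^{-1}K_I,$$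 $$W_2=(B_{II}+K_I)^{-1}\begin{pmatrix}-B_{IL}&K_I\end{pmatrix},\qquad E_L^*=W_1E_I^*\in\mathbb{R}^n_{>0}.$$ (The inverses exist.) The vector $b$ is the vector of dynamically adjusted shunt susceptances of the loads, and $Q_i<0$ corresponds to an inductive load, which consumes reactive power. The closed-loop system is differential-algebraic: its first $n$ equations are algebraic and the remaining ones are differential.
   Formalization: Uniqueness is proved only among positive/negative solutions with ‖E_L − E_L^*‖ < r, with r > 0 independent of Q_L; global uniqueness is false: for n = 1 and small Q_L < 0 the equation has two positive roots E_L, each with b < 0. *)

(* Defs.v *)
From HB Require Import structures.
From mathcomp Require Import all_boot all_order all_algebra.
From mathcomp Require Import all_classical all_reals all_analysis.

Set Implicit Arguments.
Unset Strict Implicit.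
Unset Printing Implicit Defensive.

Import Order.TTheory GRing.Theory Num.Theory.
Import numFieldNormedType.Exports.

Local Open Scope ring_scope.
Local Open Scope classical_set_scope.

Definition pos_vec (R : realType) (n : nat) (x : 'cV[R]_n) : Prop :=
  forall i, 0 < x i 0.

Definition neg_vec (R : realType) (n : nat) (x : 'cV[R]_n) : Prop :=
  forall i, x i 0 < 0.

(* The diagonal matrix [x]. *)
Definition dg (R : realType) (n : nat) (x : 'cV[R]_n) : 'M[R]_n := diag_mx x^T.

Definition connected_graph (V : finType) (e : rel V) : Prop :=
  [/\ symmetric e, irreflexive e & forall i j, connect e i j].

(* The edge weights of the graph are the off-diagonal entries of B. *)
Definition susceptance_matrix (R : realType) (N : nat) (e : rel 'I_N)
    (B : 'M[R]_N) : Prop :=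
  [/\ B^T = B,
      forall i j, e i j -> 0 < B i j,
      forall i j, i != j -> ~~ e i j -> B i j = 0
    & forall i, B i i = - \sum_(j | j != i) B i j].

(* Buses are indexed by 'I_(n + m), loads first, so that B_LL, B_LI, B_IL and
   B_II are the blocks ulsubmx B, ursubmx B, dlsubmx B and drsubmx B. *)

Definition Bred (R : realType) (n m : nat) (B : 'M[R]_(n + m))
    (K : 'cV[R]_m) : 'M[R]_n :=
  ulsubmx B - ursubmx B *m invmx (drsubmx B + dg K) *m dlsubmx B.

Definition W1 (R : realType) (n m : nat) (B : 'M[R]_(n + m))
    (K : 'cV[R]_m) : 'M[R]_(n, m) :=
  - invmx (Bred B K) *m ursubmx B *m invmx (drsubmx B + dg K) *m dg K.

Definition W2 (R : realType) (n m : nat) (B : 'M[R]_(n + m))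
    (K : 'cV[R]_m) : 'M[R]_(m, n + m) :=
  invmx (drsubmx B + dg K) *m row_mx (- dlsubmx B) (dg K).

Definition ELstar (R : realType) (n m : nat) (B : 'M[R]_(n + m))
    (K EIs : 'cV[R]_m) : 'cV[R]_n :=
  W1 B K *m EIs.

Definition Qsc (R : realType) (n m : nat) (B : 'M[R]_(n + m))
    (K EIs : 'cV[R]_m) : 'M[R]_n :=
  dg (ELstar B K EIs) *m Bred B K *m dg (ELstar B K EIs).

(* The reduced power flow equation, for a load model E_L |-> Qload E_L. *)
Definition reduced_power_flow (R : realType) (n m : nat) (B : 'M[R]_(n + m))
    (K EIs : 'cV[R]_m) (Qload : 'cV[R]_n -> 'cV[R]_n) (EL : 'cV[R]_n) : Prop :=
  0 = Qload EL + dg EL *m Bred B K *m (EL - ELstar B K EIs).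

Definition shunt_load (R : realType) (n : nat) (b EL : 'cV[R]_n) : 'cV[R]_n :=
  dg EL ^+ 2 *m b.

(* Pairs (E_L, b) of positive voltages and negative susceptances solving the
   reduced power flow equation and the steady-state load equation. *)
Definition DS_solution (R : realType) (n m : nat) (B : 'M[R]_(n + m))
    (K EIs : 'cV[R]_m) (QL EL b : 'cV[R]_n) : Prop :=
  [/\ pos_vec EL, neg_vec b,
      reduced_power_flow B K EIs (shunt_load b) EL
    & 0 = QL - shunt_load b EL].

(* The closed-loop system as a relation between the algebraic state EL, the
   differential state y = (E_I, b) and its velocity dy. Voltage magnitudes are
   restricted to positive values. *)
Definition closed_loop (R : realType) (n m : nat) (B : 'M[R]_(n + m))
    (K tau EIs : 'cV[R]_m) (T QL : 'cV[R]_n)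
    (EL : 'cV[R]_n) (y dy : 'cV[R]_m * 'cV[R]_n) : Prop :=
  let: (EI, b) := y in
  let: (dEI, db) := dy in
  let E := col_mx EL EI in
  [/\ pos_vec E,
      col_mx 0 (dg tau *m dEI) =
        col_mx (shunt_load b EL) (dg EI *m dg K *m (EI - EIs)) + dg E *m B *m E
    & dg T *m db = QL - shunt_load b EL].

(* Differential-algebraic systems S x y (dy/dt), with algebraic state x and
   differential state y; S x y dy collects the algebraic equations (in which dy
   does not occur) and the differential equations. *)

(* Solutions on [0, t1[, where t1 may be +oo. Nothing is required of a
   derivative at the endpoint 0, where the state is only continuous. *)
Definition dae_solution (R : realType) (X Y : normedModType R)
    (S : X -> Y -> Y -> Prop) (t1 : \bar R) (x : R -> X) (y : R -> Y) : Prop :=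
  [/\ {within [set t : R | 0 <= t /\ (t%:E < t1)%E], continuous x},
      {within [set t : R | 0 <= t /\ (t%:E < t1)%E], continuous y}
    & forall t : R, 0 < t -> (t%:E < t1)%E ->
        derivable y t 1 /\ S (x t) (y t) ('D_1 y t)].

Definition dae_equilibrium (R : realType) (X Y : normedModType R)
    (S : X -> Y -> Y -> Prop) (x : X) (y : Y) : Prop :=
  S x y 0.

(* Initial states compatible with the algebraic equations. *)
Definition dae_consistent (R : realType) (X Y : normedModType R)
    (S : X -> Y -> Y -> Prop) (x : X) (y : Y) : Prop :=
  exists dy, S x y dy.

(* From every consistent initial state near (xs, ys) there is a solution for
   all times t >= 0, and every solution, on whatever interval it is defined,
   obeys the exponential bound. *)
Definition locally_exponentially_stable (R : realType) (X Y : normedModType R)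
    (S : X -> Y -> Y -> Prop) (xs : X) (ys : Y) : Prop :=
  exists r M lambda : R, [/\ 0 < r, 0 < M, 0 < lambda &
    forall (x0 : X) (y0 : Y),
      dae_consistent S x0 y0 -> `|(x0 - xs, y0 - ys)| < r ->
      (exists (x : R -> X) (y : R -> Y),
         [/\ dae_solution S +oo%E x y, x 0 = x0 & y 0 = y0]) /\
      (forall (t1 : \bar R) (x : R -> X) (y : R -> Y),
         dae_solution S t1 x y -> x 0 = x0 -> y 0 = y0 ->
         forall t : R, 0 <= t -> (t%:E < t1)%E ->
           `|(x t - xs, y t - ys)|
             <= M * expR (- lambda * t) * `|(x0 - xs, y0 - ys)|)].

(* Main.v *)
Require Import Defs.
From HB Require Import structures.
From mathcomp Require Import all_boot all_order all_algebra.
From mathcomp Require Import all_classical all_reals all_analysis.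
From mathcomp Require Import ring lra.

Set Implicit Arguments.
Unset Strict Implicit.
Unset Printing Implicit Defensive.

Import Order.TTheory GRing.Theory Num.Theory.
Import numFieldNormedType.Exports.

Local Open Scope ring_scope.
Local Open Scope classical_set_scope.

(** The Laplacian - B of the network, grounded at the inverters by the droop
    gains - K, has a quadratic form bounded below by mu |z|^2 for some mu > 0,
    because the graph is connected ([network_coercive]). Eliminating the
    inverters preserves the bound, so that - Bred is positive definite
    ([Bred_coercive]); and a discrete minimum principle makes ELstar and all
    equilibrium voltages positive ([minimum_principle]).

    The equilibrium is the fixed point of E |-> ELstar - Bred^-1 (QL / E), a
    contraction of a ball around ELstar whose radius does not depend on QL, if
    QL is small. One substitution of the resulting first-order estimate into the
    equation yields the expansion ([DS_solution_exists]). The shunt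
    susceptances QL / E^2 are small with QL.

    For stability, divide the algebraic equations by the positive load voltages:
    they become linear in E_L, with matrix B_LL + [b], which is negative definite
    near the equilibrium. Hence E_L is a Lipschitz function of the differential
    state (E_I, b), with an explicit bound ([load_response]). In terms of the deviations (e_L, e_I) of the
    voltages and gamma = [E_L] (b - b^DS), a weighted sum of squares of the
    deviations of E_I and b decays at a rate of order
    |e_L|^2 + |e_I|^2 + |gamma|^2: the network form provides the
    first two terms, the load dynamics the third one, and the coupling is
    absorbed because b^DS is small compared with mu ([lyapunov_decay]). The
    estimate is made directly on the nonlinear system. It traps every solution
    that starts near the equilibrium and gives the exponential bound
    ([sublevel_decay]). Solutions exist by Picard iteration ([picard]) for the
    vector field precomposed with a projection onto a box around the
    equilibrium, which the trapped solution never notices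
    ([exponential_stability]). *)

(** * Vectors and matrices *)

Definition dot (R : realType) (n : nat) (u v : 'cV[R]_n) : R :=
  \sum_i u i 0 * v i 0.

Section vectors.
Variable R : realType.
Implicit Types n p q : nat.

Lemma cV_norm_leP n (v : 'cV[R]_n) (c : R) : 0 <= c ->
  (forall i, `|v i 0| <= c) <-> `|v| <= c.
Proof.
move=> c0; rewrite /Num.Def.normr/= mx_normrE; split=> [h|].
  by apply: bigmax_le => //= -[i j] _ /=; rewrite ord1; exact: h.
move=> h i; apply: le_trans h.
exact: (le_bigmax 0 (fun ij => `|v ij.1 ij.2|) (i, ord0)).
Qed.

Lemma coord_le_norm n (v : 'cV[R]_n) i : `|v i 0| <= `|v|.
Proof. by move: i; apply/cV_norm_leP. Qed.

Lemma entry_le_norm p q (A : 'M[R]_(p, q)) i j : `|A i j| <= `|A|.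
Proof.
by rewrite [leRHS]/Num.Def.normr/= mx_normrE; exact: (le_bigmax _ _ (i, j)).
Qed.

Lemma mulmx_norm_le p q (A : 'M[R]_(p, q)) (v : 'cV[R]_q) :
  `|A *m v| <= q%:R * `|A| * `|v|.
Proof.
apply/cV_norm_leP => [|i]; first by rewrite !mulr_ge0.
rewrite mxE (le_trans (ler_norm_sum _ _ _))//.
rewrite (le_trans (ler_sum _ (_ : forall j, _ -> _ <= `|A| * `|v|)))//; last first.
  by rewrite sumr_const card_ord -mulrA mulr_natl.
by move=> j _; rewrite normrM ler_pM// ?entry_le_norm// coord_le_norm.
Qed.

Lemma dotvv_ge0 n (v : 'cV[R]_n) : 0 <= dot v v.
Proof. by apply: sumr_ge0 => i _; rewrite -expr2 sqr_ge0. Qed.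

Lemma norm_le_dotvv n (v : 'cV[R]_n) : `|v| ^+ 2 <= dot v v.
Proof.
have coord i : v i 0 ^+ 2 <= dot v v.
  rewrite /dot (bigD1 i)//= -expr2 lerDl.
  by apply: sumr_ge0 => j _; rewrite -expr2 sqr_ge0.
rewrite -(sqr_sqrtr (dotvv_ge0 v)) ler_pXn2r// ?nnegrE// ?sqrtr_ge0//.
apply/cV_norm_leP => [|i]; first exact: sqrtr_ge0.
by rewrite -sqrtr_sqr ler_sqrt// dotvv_ge0.
Qed.

Lemma dot_le_norm n (u v : 'cV[R]_n) : dot u v <= n%:R * `|u| * `|v|.
Proof.
rewrite (le_trans (ler_sum _ (_ : forall i, _ -> _ <= `|u| * `|v|)))//.
  move=> i _; rewrite (le_trans (ler_norm _))// normrM.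
  by rewrite ler_pM// coord_le_norm.
by rewrite sumr_const card_ord -mulrA mulr_natl.
Qed.

Lemma dgE n p (x : 'cV[R]_n) (A : 'M[R]_(n, p)) i j :
  (dg x *m A) i j = x i 0 * A i j.
Proof. by rewrite /dg mul_diag_mx !mxE. Qed.

Lemma coordD n (x y : 'cV[R]_n) i : (x + y) i 0 = x i 0 + y i 0.
Proof. by rewrite mxE. Qed.

Lemma coordN n (x : 'cV[R]_n) i : (- x) i 0 = - x i 0.
Proof. by rewrite mxE. Qed.

Definition coordE := (coordD, coordN, dgE).

Lemma pos_vec_lb n (x : 'cV[R]_n) : pos_vec x ->
  exists2 a : R, 0 < a & forall i, a <= x i 0.
Proof.
move=> x0; exists (\big[Num.min/1]_i x i 0).
  by apply/bigmin_gtP; split.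
by move=> i; exact: bigmin_le_cond.
Qed.

(** A vector in the kernel of A has a vanishing quadratic form. *)
Lemma coercive_unitmx n (A : 'M[R]_n) (mu : R) : 0 < mu ->
  (forall v : 'cV[R]_n, mu * dot v v <= - dot v (A *m v)) -> A \in unitmx.
Proof.
move=> mu0 cA; rewrite -unitmx_tr -row_free_unit -kermx_eq0.
apply/eqP/row_matrixP => i; rewrite row0.
set w := row i _.
have Aw : A *m w^T = 0.
  by rewrite -[A]trmxK -trmx_mul /w -row_mul mulmx_ker row0 trmx0.
have := cA w^T; rewrite Aw.
have -> : dot w^T (0 : 'cV_n) = 0.
  by rewrite /dot big1// => j _; rewrite [X in _ * X]mxE mulr0.
rewrite oppr0 pmulr_rle0// => w0.
have : `|w^T| ^+ 2 <= 0 := le_trans (norm_le_dotvv _) w0.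
rewrite le_eqVlt ltNge sqr_ge0 orbF expf_eq0/= normr_eq0 => /eqP.
by move=> /(congr1 trmx); rewrite trmxK trmx0.
Qed.
End vectors.

(** * Grounded Laplacians of connected graphs *)

Section network.
Variables (R : realType) (N : nat) (e : rel 'I_N) (B : 'M[R]_N).
Hypotheses (he : connected_graph e) (hB : susceptance_matrix e B).

Lemma susceptance_ge0 i j : i != j -> 0 <= B i j.
Proof.
case: hB => _ pos zero _ ij; have [/pos/ltW //|/zero ->//] := boolP (e i j).
Qed.

Lemma susceptance_mul (z : 'cV[R]_N) i :
  (B *m z) i 0 = - \sum_j B i j * (z i 0 - z j 0).
Proof.
case: hB => _ _ _ diag; rewrite mxE -sumrN (bigD1 i)//= [RHS](bigD1 i)//=.
rewrite subrr mulr0 oppr0 add0r diag mulNr mulr_suml addrC -sumrB.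
by apply: eq_bigr => j _; ring.
Qed.

(** Minus the Dirichlet energy of z: sum the identity for z . B z with its
    transpose, B being symmetric with zero row sums. *)
Lemma susceptance_form (z : 'cV[R]_N) :
  dot z (B *m z) = - (\sum_i \sum_j B i j * (z i 0 - z j 0) ^+ 2) / 2.
Proof.
have symB i j : B i j = B j i by have [BT _ _ _] := hB; rewrite -{1}BT mxE.
have E1 : dot z (B *m z) = - \sum_i \sum_j B i j * (z i 0 - z j 0) * z i 0.
  rewrite /dot -sumrN; apply: eq_bigr => i _.
  rewrite susceptance_mul mulrN mulr_sumr; congr (- _).
  by apply: eq_bigr => j _; ring.
have E2 : dot z (B *m z) = \sum_i \sum_j B i j * (z i 0 - z j 0) * z j 0.
  rewrite E1 exchange_big -sumrN/=; apply: eq_bigr => i _.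
  by rewrite -sumrN; apply: eq_bigr => j _; rewrite (symB j i); ring.
have : dot z (B *m z) + dot z (B *m z) =
       - \sum_i \sum_j B i j * (z i 0 - z j 0) ^+ 2.
  rewrite {1}E1 E2 addrC -sumrB -sumrN; apply: eq_bigr => i _.
  rewrite -sumrB -sumrN; apply: eq_bigr => j _; ring.
by move=> h; lra.
Qed.

Lemma connect_ind (P : 'I_N -> Prop) i0 : P i0 ->
  (forall i j, e i j -> P i -> P j) -> forall i, P i.
Proof.
move=> P0 Pe i; case: he => _ _ /(_ i0 i)/connectP[p + ->].
by elim: p i0 P0 => [|j p IH] i0 P0 //= /andP[eij /IH]; apply; exact: Pe eij P0.
Qed.

(** The energy H z of a Laplacian grounded with conductances d bounds
    d_i0 z_i0 ^ 2 at a grounded node i0 and the square of every voltage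
    difference along an edge. Following a path from i0, it bounds each z_i ^ 2
    up to a constant; mu is the inverse of the sum of these constants. *)
Lemma network_coercive (d : 'cV[R]_N) (i0 : 'I_N) :
  (forall i, 0 <= d i 0) -> 0 < d i0 0 ->
  exists2 mu : R, 0 < mu &
    forall z, mu * dot z z <= dot z (dg d *m z) - dot z (B *m z).
Proof.
move=> d0 di0.
pose H z := dot z (dg d *m z) - dot z (B *m z).
pose g (z : 'cV[R]_N) i j := B i j * (z i 0 - z j 0) ^+ 2.
have g0 z i j : 0 <= g z i j.
  have [->|ij] := eqVneq i j; first by rewrite /g subrr expr0n mulr0.
  by rewrite mulr_ge0 ?sqr_ge0 ?susceptance_ge0.
have dz0 (z : 'cV[R]_N) i : 0 <= z i 0 * (dg d *m z) i 0.
  by rewrite dgE mulrCA mulr_ge0// -expr2 sqr_ge0.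
have HE z : H z = dot z (dg d *m z) + (\sum_i \sum_j g z i j) / 2.
  by rewrite /H susceptance_form mulNr opprK.
have gs0 z : 0 <= \sum_i \sum_j g z i j.
  by do 2! apply: sumr_ge0 => ? _.
have Hd (z : 'cV[R]_N) i : d i 0 * z i 0 ^+ 2 <= H z.
  rewrite HE (@le_trans _ _ (dot z (dg d *m z)))//; last first.
    by rewrite lerDl divr_ge0.
  rewrite /dot (bigD1 i)//= dgE expr2 mulrCA lerDl.
  by apply: sumr_ge0.
have Hg z i j : g z i j <= 2 * H z.
  have : g z i j <= \sum_i \sum_j g z i j.
    rewrite (bigD1 i)//= (bigD1 j)//= -addrA lerDl addr_ge0// sumr_ge0// => k _.
    by rewrite sumr_ge0.
  have : 0 <= dot z (dg d *m z) by apply: sumr_ge0.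
  rewrite HE; lra.
have H0 z : 0 <= H z by apply: le_trans (Hd z i0); rewrite mulr_ge0// sqr_ge0.
have bound i : exists2 c : R, 0 < c & forall z : 'cV[R]_N, z i 0 ^+ 2 <= c * H z.
  move: i; apply: (connect_ind (i0 := i0)) => [|i j eij [c c0 hc]].
    exists (d i0 0)^-1 => [|z]; first by rewrite invr_gt0.
    by rewrite ler_pdivlMl.
  have Bij : 0 < B i j by case: hB => _ + _ _; exact.
  (* z_j ^ 2 <= 2 z_i ^ 2 + 2 (z_i - z_j) ^ 2 and B_ij (z_i - z_j) ^ 2 <= 2 H z *)
  exists (2 * c + 4 / B i j) => [|z].
    by rewrite addr_gt0// mulr_gt0// invr_gt0.
  have h1 : (z i 0 - z j 0) ^+ 2 <= 2 * H z / B i j.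
    by rewrite ler_pdivlMr// mulrC; exact: Hg.
  have h2 := hc z.
  have h3 := sqr_ge0 (2 * z i 0 - z j 0).
  have -> : (2 * c + 4 / B i j) * H z = 2 * (c * H z) + 2 * (2 * H z / B i j).
    by ring.
  by nra.
have [c hc] : exists c : 'I_N -> R,
    forall i, 0 < c i /\ forall z : 'cV[R]_N, z i 0 ^+ 2 <= c i * H z.
  have [c hc] := @choice _ _
    (fun i c => 0 < c /\ forall z : 'cV[R]_N, z i 0 ^+ 2 <= c * H z)
    (fun i => let: ex_intro2 c c0 hc := bound i in ex_intro _ c (conj c0 hc)).
  by exists c.
have C0 : 0 < \sum_i c i.
  rewrite (bigD1 i0)//= ltr_pwDl//; first by case: (hc i0).
  by apply: sumr_ge0 => i _; apply/ltW; case: (hc i).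
exists (\sum_i c i)^-1 => [|z]; first by rewrite invr_gt0.
rewrite ler_pdivrMl// mulr_suml; apply: ler_sum => i _.
by rewrite -expr2; case: (hc i).
Qed.

(** At a node where a nonpositive minimum is attained, the grounded Laplacian
    is a sum of nonpositive terms, which must vanish: every neighbour attains
    the minimum as well, hence so does i0, where the Laplacian is positive. *)
Lemma minimum_principle (d z : 'cV[R]_N) (i0 : 'I_N) :
  (forall i, 0 <= d i 0) ->
  (forall i, 0 <= d i 0 * z i 0 - (B *m z) i 0) ->
  0 < d i0 0 * z i0 0 - (B *m z) i0 0 ->
  pos_vec z.
Proof.
move=> d0 sup sup0.
have [k kmin] : exists k, forall j, z k 0 <= z j 0.
  exists [arg min_(k < i0) z k 0]%O; case: arg_minP => // k _ h j; exact: h.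
case: (ltP 0 (z k 0)) => [zk i|zk]; first exact: lt_le_trans (kmin i).
have flat i : z i 0 = z k 0 ->
    d i 0 * z i 0 <= 0 /\ forall j, B i j * (z i 0 - z j 0) <= 0.
  move=> zi; split=> [|j]; first by rewrite zi mulr_ge0_le0.
  have [->|ij] := eqVneq i j; first by rewrite subrr mulr0.
  by rewrite mulr_ge0_le0 ?susceptance_ge0// zi subr_le0.
have zconst : forall i, z i 0 = z k 0.
  apply: (connect_ind (i0 := k)) => // i j eij zi.
  have [di Bi] := flat i zi.
  have := sup i; rewrite susceptance_mul opprK (bigD1 j)//=.
  have : \sum_(i1 | i1 != j) B i i1 * (z i 0 - z i1 0) <= 0 by apply: sumr_le0.
  have Bij : 0 < B i j by case: hB => _ + _ _; exact.
  have := Bi j; rewrite pmulr_rle0// subr_le0 => zij hs hsup.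
  have : 0 <= B i j * (z i 0 - z j 0) by lra.
  by rewrite pmulr_rge0// subr_ge0 zi => zjk; apply/eqP; rewrite eq_le zjk kmin.
have [di Bi] := flat i0 (zconst i0).
move: sup0; rewrite susceptance_mul opprK.
have : \sum_j B i0 j * (z i0 0 - z j 0) <= 0 by apply: sumr_le0.
by move=> h1 h2; lra.
Qed.

End network.

(** * Elimination of the inverters *)

Section blocks.
Variable R : realType.

Lemma dot_col n m (a c : 'cV[R]_n) (b d : 'cV[R]_m) :
  dot (col_mx a b) (col_mx c d) = dot a c + dot b d.
Proof.
rewrite /dot big_split_ord/=; congr (_ + _); apply: eq_bigr => i _.
  by rewrite !col_mxEu.
by rewrite !col_mxEd.
Qed.

Lemma block_mul n m (B : 'M[R]_(n + m)) (zl : 'cV[R]_n) (zi : 'cV[R]_m) :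
  B *m col_mx zl zi = col_mx (ulsubmx B *m zl + ursubmx B *m zi)
                             (dlsubmx B *m zl + drsubmx B *m zi).
Proof. by rewrite -{1}[B]submxK mul_block_col. Qed.

Lemma dg_unit n (x : 'cV[R]_n) : (forall i, x i 0 != 0) -> dg x \in unitmx.
Proof.
move=> x0; rewrite unitmxE det_diag unitfE; apply/prodf_neq0 => i _.
by rewrite mxE.
Qed.

Lemma shunt_loadE n (b EL : 'cV[R]_n) i :
  shunt_load b EL i 0 = EL i 0 ^+ 2 * b i 0.
Proof. by rewrite /shunt_load expr2 -mulmxE -mulmxA !dgE mulrA expr2. Qed.

Lemma dg_col n m (a c : 'cV[R]_n) (b d : 'cV[R]_m) :
  dg (col_mx a b) *m col_mx c d = col_mx (dg a *m c) (dg b *m d).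
Proof.
apply/matrixP => i j; rewrite dgE; case: (split_ordP i) => k ->.
  by rewrite !col_mxEu dgE.
by rewrite !col_mxEd dgE.
Qed.

Lemma pos_vec_col n m (a : 'cV[R]_n) (b : 'cV[R]_m) :
  pos_vec (col_mx a b) <-> pos_vec a /\ pos_vec b.
Proof.
split=> [h|[ha hb] i].
  by split=> i; [have := h (lshift m i)|have := h (rshift n i)];
    rewrite ?col_mxEu ?col_mxEd.
by case: (split_ordP i) => k ->; rewrite ?col_mxEu ?col_mxEd.
Qed.
End blocks.

(** The blocks spell out the quadratic form of - (B + diag (0, K)) at
    z = (zl, zi), so that zl or zi can be specialized separately. *)
Definition coercive_network (R : realType) (n m : nat) (B : 'M[R]_(n + m))
    (K : 'cV[R]_m) (mu : R) : Prop :=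
  forall (zl : 'cV[R]_n) (zi : 'cV[R]_m),
  mu * (dot zl zl + dot zi zi) <=
    - (dot zl (ulsubmx B *m zl + ursubmx B *m zi) +
       dot zi (dlsubmx B *m zl + (drsubmx B + dg K) *m zi)).

Section reduction.
Variables (R : realType) (n m : nat) (B : 'M[R]_(n + m)) (K : 'cV[R]_m).
Variable mu : R.
Hypothesis mu0 : 0 < mu.
Hypothesis coercive : coercive_network B K mu.

Lemma dot0l p (v : 'cV[R]_p) : dot 0 v = 0.
Proof. by rewrite /dot big1// => i _; rewrite mxE mul0r. Qed.

Lemma dot0r p (v : 'cV[R]_p) : dot v 0 = 0.
Proof. by rewrite /dot big1// => i _; rewrite mxE mulr0. Qed.

Lemma dotDr p (u v w : 'cV[R]_p) : dot u (v + w) = dot u v + dot u w.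
Proof. by rewrite /dot -big_split; apply: eq_bigr => i _; rewrite mxE mulrDr. Qed.

Lemma inverter_block_unit : drsubmx B + dg K \in unitmx.
Proof.
apply: (coercive_unitmx mu0) => v; have := coercive 0 v.
by rewrite !mulmx0 !dot0l !add0r.
Qed.

Let Binv := invmx (drsubmx B + dg K).

(** Bred is a Schur complement: its quadratic form at v is that of the network
    at (v, w), with w the inverter voltages for which the inverter rows vanish. *)
Lemma Bred_coercive (v : 'cV[R]_n) :
  mu * dot v v <= - dot v (Bred B K *m v).
Proof.
have := coercive v (- (Binv *m (dlsubmx B *m v))).
rewrite !mulmxN mulKVmx ?inverter_block_unit// addrN dot0r addr0.
rewrite /Bred mulmxBl -!mulmxA; apply: le_trans.
by rewrite ler_wpM2l ?(ltW mu0)// lerDl dotvv_ge0.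
Qed.

Lemma Bred_unit : Bred B K \in unitmx.
Proof. by apply: (coercive_unitmx mu0) => v; exact: Bred_coercive. Qed.

(** Negative susceptances b only strengthen coercivity; positive ones are
    tolerated up to the margin mu - k. *)
Lemma load_block_coercive (b v : 'cV[R]_n) (k : R) :
  (forall i, b i 0 <= mu - k) ->
  k * dot v v <= - dot v ((ulsubmx B + dg b) *m v).
Proof.
move=> bk; have := coercive v 0.
rewrite !mulmx0 !dot0l !addr0 mulmxDl dotDr => h.
have : dot v (dg b *m v) <= (mu - k) * dot v v.
  rewrite /dot mulr_sumr; apply: ler_sum => i _.
  by rewrite dgE mulrCA ler_wpM2r// -expr2 sqr_ge0.
by rewrite mulrBl; lra.
Qed.

Variable EIs : 'cV[R]_m.

(** The inverter voltages at which the droop controllers are at rest, for given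
    load voltages. *)
Definition inverter_voltages (EL : 'cV[R]_n) : 'cV[R]_m := W2 B K *m col_mx EL EIs.

Lemma inverter_balance EL :
  dlsubmx B *m EL + drsubmx B *m inverter_voltages EL + dg K *m inverter_voltages EL =
    dg K *m EIs.
Proof.
rewrite -addrA -mulmxDl /inverter_voltages /W2 -!mulmxA mulKVmx ?inverter_block_unit//.
by rewrite mul_row_col mulNmx addrA subrr add0r.
Qed.

Lemma load_balance EL :
  ulsubmx B *m EL + ursubmx B *m inverter_voltages EL = Bred B K *m (EL - ELstar B K EIs).
Proof.
rewrite /inverter_voltages /W2 /ELstar /W1 mulmxBr !mulNmx mulmxN !mulmxA.
rewrite mulmxV ?Bred_unit//.
rewrite mul1mx opprK -!mulmxA mul_row_col mulNmx !mulmxDr !mulmxN.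
by rewrite /Bred mulmxBl -!mulmxA addrA.
Qed.

End reduction.

(** * Existence, uniqueness and expansion of the equilibrium *)

HB.instance Definition _ (R : realType) (m n : nat) :=
  Uniform_isComplete.Build 'M[R]_(m, n) cauchy_cvg.

Lemma ball_fixed_point (R : realType) (X : completeNormedModType R) (c : X)
    (a : R) (f : X -> X) : 0 <= a ->
  (forall x, `|x - c| <= a -> `|f x - c| <= a) ->
  (forall x y, `|x - c| <= a -> `|y - c| <= a -> `|f x - f y| <= 2^-1 * `|x - y|) ->
  exists2 x, `|x - c| <= a & x = f x.
Proof.
move=> a0 fU flip; pose U := closed_ball_ (@Num.Def.normr R X) c a.
have fUU : {homo f : x / U x >-> U x}.
  by move=> x; rewrite /U /closed_ball_/= ![`|c - _|]distrC; exact: fU.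
have h2 : (0 : R) <= 2^-1 by rewrite invr_ge0.
have ctr : is_contraction (mkfun_fun fUU).
  exists (NngNum h2); split=> /=; first by rewrite invf_lt1// ltr1n.
  move=> [x y] [/= Ux Uy]; apply: flip; rewrite distrC; [exact: Ux|exact: Uy].
have [| |x Ux xf] := banach_fixed_point ctr.
- exact: closed_closed_ball_.
- by exists c; rewrite /U /closed_ball_/= subrr normr0.
- by exists x => //; rewrite distrC.
Qed.

Section equilibrium.
Variables (R : realType) (n m : nat) (hm : (1 <= m)%N).
Variables (e : rel 'I_(n + m)) (B : 'M[R]_(n + m)) (K EIs : 'cV[R]_m).
Hypotheses (he : connected_graph e) (hB : susceptance_matrix e B).
Hypotheses (hK : neg_vec K) (hEIs : pos_vec EIs).

Lemma power_network_coercive : exists2 mu : R, 0 < mu &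
  coercive_network B K mu.
Proof.
pose d : 'cV[R]_(n + m) := col_mx 0 (- K).
have [||mu mu0 hmu] := network_coercive he hB (d := d) (i0 := rshift n (Ordinal hm)).
- move=> i; rewrite /d; case: (split_ordP i) => k ->; first by rewrite col_mxEu mxE.
  by rewrite col_mxEd mxE oppr_ge0 ltW.
- by rewrite /d col_mxEd mxE oppr_gt0.
exists mu => // zl zi; have := hmu (col_mx zl zi).
rewrite (block_mul B) /d dg_col !dot_col mulmxDl addrA => /le_trans; apply.
have -> : dg (0 : 'cV[R]_n) *m zl = 0.
  by apply/matrixP => i j; rewrite dgE !mxE mul0r.
have -> : dg (- K) *m zi = - (dg K *m zi).
  by apply/matrixP => i j; rewrite [RHS]mxE !dgE mxE mulNr.
rewrite dot0r add0r [dot zi (_ + dg K *m zi)]dotDr.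
have -> : dot zi (- (dg K *m zi)) = - dot zi (dg K *m zi).
  by rewrite /dot -sumrN; apply: eq_bigr => i _; rewrite mxE mulrN.
lra.
Qed.

(** The minimum principle, with shunt conductances - b at the loads and - K at
    the inverters; the droop set points inject a positive current. *)
Lemma network_voltages_pos (b EL : 'cV[R]_n) (EI : 'cV[R]_m) :
  (forall i, b i 0 <= 0) ->
  dg b *m EL + (ulsubmx B *m EL + ursubmx B *m EI) = 0 ->
  dlsubmx B *m EL + drsubmx B *m EI + dg K *m EI = dg K *m EIs ->
  pos_vec EL /\ pos_vec EI.
Proof.
move=> b0 hL hI; apply/pos_vec_col.
pose d : 'cV[R]_(n + m) := col_mx (- b) (- K).
have rowI (k : 'I_m) : d (rshift n k) 0 * (col_mx EL EI) (rshift n k) 0 -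
    (B *m col_mx EL EI) (rshift n k) 0 = - K k 0 * EIs k 0.
  rewrite block_mul /d !col_mxEd mxE.
  move/matrixP : hI => /(_ k 0); rewrite [LHS]mxE !dgE => h.
  by rewrite !mulNr -h; ring.
apply: (minimum_principle he hB (d := d) (i0 := rshift n (Ordinal hm))).
- move=> i; rewrite /d; case: (split_ordP i) => k ->.
    by rewrite col_mxEu mxE oppr_ge0.
  by rewrite col_mxEd mxE oppr_ge0 ltW.
- move=> i; case: (split_ordP i) => k ->; last first.
    by rewrite rowI mulr_ge0 ?oppr_ge0 ?ltW.
  rewrite block_mul /d !col_mxEu mxE.
  move/matrixP : hL => /(_ k 0); rewrite [LHS]mxE dgE [RHS]mxE => h.
  by rewrite le_eqVlt; apply/orP; left; apply/eqP; lra.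
- by rewrite rowI mulr_gt0 ?oppr_gt0.
Qed.

Lemma ELstar_pos : pos_vec (ELstar B K EIs).
Proof.
have [mu mu0 hmu] := power_network_coercive.
have [//|||//] := @network_voltages_pos 0 (ELstar B K EIs)
  (inverter_voltages B K EIs (ELstar B K EIs)).
- by move=> i; rewrite mxE.
- rewrite (load_balance mu0 hmu) subrr mulmx0 addr0.
  by apply/matrixP => i j; rewrite dgE !mxE mul0r.
- exact: inverter_balance mu0 hmu _ _.
Qed.

Lemma DS_solutionP (Q EL b : 'cV[R]_n) : neg_vec Q -> pos_vec EL ->
  DS_solution B K EIs Q EL b <->
  (forall i, b i 0 = Q i 0 / EL i 0 ^+ 2) /\
  Bred B K *m (EL - ELstar B K EIs) = - \col_i (Q i 0 / EL i 0).
Proof.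
move=> Q0 EL0; have EL_neq0 i : EL i 0 != 0 by rewrite gt_eqF.
split=> [[_ _ hrpf hQ]|[hb hr]].
  have hb i : b i 0 = Q i 0 / EL i 0 ^+ 2.
    move/matrixP : hQ => /(_ i 0); rewrite [LHS]mxE [RHS]mxE [X in _ + X]mxE.
    by rewrite shunt_loadE => /eqP; rewrite eq_sym subr_eq0 => /eqP ->; field.
  split=> //; apply/matrixP => i j; rewrite ord1 [RHS]mxE [in RHS]mxE.
  move/matrixP : hrpf => /(_ i 0); rewrite [LHS]mxE [RHS]mxE shunt_loadE.
  rewrite -mulmxA dgE hb => h.
  apply: (mulfI (EL_neq0 i)); rewrite -[RHS]addr0 {}h; field; exact: EL_neq0.
have hQ i : EL i 0 ^+ 2 * b i 0 = Q i 0 by rewrite hb; field; exact: EL_neq0.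
split => //.
- by move=> i; rewrite hb pmulr_llt0// invr_gt0 exprn_gt0.
- apply/matrixP => i j; rewrite ord1 [LHS]mxE [RHS]mxE shunt_loadE -mulmxA dgE.
  by rewrite hr hQ 2!mxE; field; exact: EL_neq0.
- apply/matrixP => i j; rewrite ord1 [LHS]mxE [RHS]mxE [X in _ + X]mxE.
  by rewrite shunt_loadE hQ subrr.
Qed.

(** For positive E, the two steady-state equations amount to the fixed-point
    equation E = Es - Bred^-1 (Q / E), with b = Q / E ^ 2. On the ball of radius
    a around Es = ELstar all entries of E are at least a, and the right-hand side is a
    contraction of the ball once the product of |Q| and the norm of Bred^-1 is
    at most a ^ 2 / 2. The expansion
    comes from inserting E = Es + O(|Q|) into the right-hand side once. The
    last clause makes the load susceptances as small as needed for stability. *)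
Lemma DS_solution_exists (d : R) : 0 < d ->
  exists delta C r : R, [/\ 0 < delta, 0 < C, 0 < r &
  forall Q : 'cV[R]_n, neg_vec Q -> `|Q| < delta ->
  exists EL b : 'cV[R]_n,
  [/\ DS_solution B K EIs Q EL b /\ `|EL - ELstar B K EIs| < r,
      forall EL' b' : 'cV[R]_n,
        DS_solution B K EIs Q EL' b' -> `|EL' - ELstar B K EIs| < r ->
        EL' = EL /\ b' = b,
      exists epsilon : 'cV[R]_n,
        EL = dg (ELstar B K EIs) *m
               (const_mx 1 - invmx (Qsc B K EIs) *m Q + epsilon) /\
        `|epsilon| <= C * `|invmx (Qsc B K EIs) *m Q| ^+ 2,
      b = invmx (dg EL ^+ 2) *m Q
    & forall i, - d <= b i 0]].
Proof.
move=> d0; have [mu mu0 hmu] := power_network_coercive.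
have [a2 a20 ha2] := pos_vec_lb ELstar_pos.
set Es := ELstar B K EIs in ha2 *; set Br := Bred B K.
have Bu : Br \in unitmx := Bred_unit mu0 hmu.
pose a := a2 / 2; have a0 : 0 < a by rewrite divr_gt0.
have aEs i : a <= Es i 0 by rewrite (le_trans _ (ha2 i))// ler_pdivrMr//; lra.
have near_a (E : 'cV[R]_n) i : `|E - Es| <= a -> a <= E i 0.
  move=> h; have := ha2 i; have := le_trans (coord_le_norm (E - Es) i) h.
  by rewrite !mxE ler_norml /a => /andP[]; lra.
pose C0 : R := n%:R * `|invmx Br| + 1.
have C0_gt0 : 0 < C0 by rewrite ltr_wpDl// mulr_ge0.
have hC0 (v : 'cV[R]_n) : `|invmx Br *m v| <= C0 * `|v|.
  rewrite (le_trans (mulmx_norm_le _ _))// ler_wpM2r//.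
  by rewrite /C0; lra.
pose q (Q E : 'cV[R]_n) : 'cV[R]_n := \col_i (Q i 0 / E i 0).
have qle (Q E : 'cV[R]_n) : (forall i, a <= E i 0) -> `|q Q E| <= `|Q| / a.
  move=> aE; apply/cV_norm_leP => [|i]; first by rewrite divr_ge0// ltW.
  have E0 : 0 < E i 0 := lt_le_trans a0 (aE i).
  rewrite mxE normrM normfV (gtr0_norm E0) ler_pM// ?invr_ge0 ?(ltW E0)//.
    exact: coord_le_norm.
  by rewrite lef_pV2.
have qlip (Q E E' : 'cV[R]_n) : (forall i, a <= E i 0) -> (forall i, a <= E' i 0) ->
    `|q Q E - q Q E'| <= `|Q| / a ^+ 2 * `|E - E'|.
  move=> aE aE'; apply/cV_norm_leP => [|i].
    by rewrite mulr_ge0// divr_ge0// sqr_ge0.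
  have E0 : 0 < E i 0 := lt_le_trans a0 (aE i).
  have E'0 : 0 < E' i 0 := lt_le_trans a0 (aE' i).
  have -> : (q Q E - q Q E') i 0 =
      Q i 0 * (E i 0 * E' i 0)^-1 * (E' - E) i 0.
    by rewrite !mxE; field; rewrite !gt_eqF.
  rewrite !normrM -[`|E - E'|]normrN opprB ler_pM// ?coord_le_norm//.
  rewrite ler_pM// ?coord_le_norm//.
  rewrite normfV gtr0_norm ?mulr_gt0// lef_pV2 ?posrE ?mulr_gt0 ?exprn_gt0//.
  by rewrite expr2 ler_pM// ltW.
pose f (Q E : 'cV[R]_n) : 'cV[R]_n := Es - invmx Br *m q Q E.
(* The two bounds make f a contraction and - d <= b, respectively. *)
pose delta : R := Num.min (a ^+ 2 / (2 * C0)) (d * a ^+ 2).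
have delta0 : 0 < delta.
  by rewrite lt_min !mulr_gt0 ?invr_gt0 ?mulr_gt0 ?exprn_gt0.
have Esu : dg Es \in unitmx by apply: dg_unit => i; rewrite gt_eqF// ELstar_pos.
have Qscu : Qsc B K EIs \in unitmx.
  by rewrite /Qsc -/Es -/Br !unitmx_mul Esu Bu.
pose CQ : R := n%:R * `|Qsc B K EIs|.
have CQ0 : 0 <= CQ by rewrite mulr_ge0.
exists delta, (C0 ^+ 2 / a ^+ 4 * CQ ^+ 2 + 1), a; split => //.
  by rewrite ltr_wpDl// mulr_ge0 ?sqr_ge0// divr_ge0// exprn_ge0 ?ltW.
move=> Q Q0; rewrite lt_min => /andP[Q1 Q2].
have Qd : C0 * `|Q| <= a ^+ 2 / 2.
  by move: (ltW Q1); rewrite !ler_pdivlMr ?mulr_gt0//; lra.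
have fball (E : 'cV[R]_n) : `|E - Es| <= a -> `|f Q E - Es| <= a / 2.
  move=> h; rewrite /f addrAC subrr add0r normrN (le_trans (hC0 _))//.
  rewrite (@le_trans _ _ (C0 * (`|Q| / a)))//.
    by rewrite ler_wpM2l ?(ltW C0_gt0)// qle// => i; exact: near_a.
  rewrite mulrA ler_pdivrMr// (le_trans Qd)//; lra.
have flip (E E' : 'cV[R]_n) : `|E - Es| <= a -> `|E' - Es| <= a ->
    `|f Q E - f Q E'| <= 2^-1 * `|E - E'|.
  move=> hE hE'; rewrite /f opprB addrC addrA subrK -mulmxBr.
  rewrite (le_trans (hC0 _))//.
  rewrite (@le_trans _ _ (C0 * (`|Q| / a ^+ 2 * `|E' - E|)))//.
    by rewrite ler_wpM2l ?(ltW C0_gt0)// qlip// => i; exact: near_a.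
  rewrite distrC 2!mulrA ler_wpM2r// ler_pdivrMr ?exprn_gt0//.
  by rewrite (le_trans Qd)//; lra.
have solP (E b : 'cV[R]_n) : `|E - Es| <= a -> DS_solution B K EIs Q E b <->
    (forall i, b i 0 = Q i 0 / E i 0 ^+ 2) /\ E = f Q E.
  move=> hE; have E0 : pos_vec E by move=> i; rewrite (lt_le_trans a0)// near_a.
  rewrite (DS_solutionP _ Q0 E0) -/Es -/Br -/(q Q E).
  split=> -[hb h]; split=> //; last first.
    by rewrite {1}h /f addrAC subrr add0r mulmxN mulKVmx.
  have hh : E - Es = - (invmx Br *m q Q E) by rewrite -[LHS](mulKmx Bu) h mulmxN.
  by rewrite /f -hh addrC subrK.
have [|EL hEL ELf] := ball_fixed_point (ltW a0) _ flip.
  by move=> E hE; rewrite (le_trans (fball _ hE))//; lra.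
pose b : 'cV[R]_n := \col_i (Q i 0 / EL i 0 ^+ 2).
have EL0 i : 0 < EL i 0 by rewrite (lt_le_trans a0)// near_a.
have ELhalf : `|EL - Es| <= C0 * (`|Q| / a).
  rewrite {1}ELf /f addrAC subrr add0r normrN (le_trans (hC0 _))//.
  by rewrite ler_wpM2l ?(ltW C0_gt0)// qle// => i; exact: near_a.
exists EL, b; split.
- split; first by apply/solP => //; split=> // i; rewrite mxE.
  by rewrite ELf (le_lt_trans (fball _ hEL))//; lra.
- move=> E' b' sol' hE'; have [hb' E'f] := (solP _ _ (ltW hE')).1 sol'.
  have E'E : E' = EL.
    have := flip _ _ (ltW hE') hEL; rewrite -E'f -ELf => h.
    have : `|E' - EL| <= 0 by lra.
    by rewrite normr_le0 subr_eq0 => /eqP.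
  by split => //; apply/matrixP => i j; rewrite ord1 hb' mxE E'E.
- set w := invmx (Qsc B K EIs) *m Q.
  have hw : Qsc B K EIs *m w = Q by rewrite /w mulKVmx.
  have Qw : `|Q| <= CQ * `|w| by rewrite -{1}hw; exact: mulmx_norm_le.
  pose eps : 'cV[R]_n := \col_i ((EL i 0 - Es i 0) / Es i 0 + w i 0).
  have Es0 i : 0 < Es i 0 by exact: ELstar_pos.
  exists eps; split.
    apply/matrixP => i j; rewrite ord1 dgE [(_ + eps) i 0]mxE [(_ - w) i 0]mxE.
    rewrite [const_mx 1 i 0]mxE [(- w) i 0]mxE [eps i 0]mxE; field.
    by rewrite gt_eqF.
  have heps : dg Es *m eps = invmx Br *m (q Q Es - q Q EL).
    have Ew : dg Es *m w = invmx Br *m q Q Es.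
      rewrite -[LHS](mulKmx Bu); congr (_ *m _); apply/matrixP => i j.
      rewrite ord1 [RHS]mxE -hw /Qsc -/Es -/Br -!mulmxA dgE.
      by rewrite mulrAC mulfV ?mul1r// gt_eqF.
    rewrite mulmxBr -Ew.
    have -> : invmx Br *m q Q EL = Es - EL by rewrite {2}ELf /f opprB addrC subrK.
    apply/matrixP => i j; rewrite ord1 dgE [eps i 0]mxE [RHS]mxE dgE.
    rewrite [(- (Es - EL)) i 0]mxE [(Es - EL) i 0]mxE [(- EL) i 0]mxE; field.
    by rewrite gt_eqF.
  have h1 : `|dg Es *m eps| <= C0 * (`|Q| / a ^+ 2 * (C0 * (`|Q| / a))).
    rewrite heps (le_trans (hC0 _))// ler_wpM2l ?(ltW C0_gt0)//.
    rewrite (le_trans (qlip _ _ _ aEs (fun i => near_a _ i hEL)))//.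
    by rewrite ler_wpM2l ?divr_ge0 ?sqr_ge0// distrC.
  have h2 : a * `|eps| <= `|dg Es *m eps|.
    rewrite -ler_pdivlMl//; apply/cV_norm_leP => [|i].
      by rewrite mulr_ge0// invr_ge0 ltW.
    rewrite ler_pdivlMl// (le_trans _ (coord_le_norm _ i))// dgE normrM.
    by rewrite ler_wpM2r// gtr0_norm.
  have h3 : `|eps| <= C0 ^+ 2 / a ^+ 4 * `|Q| ^+ 2.
    move: (le_trans h2 h1); rewrite -ler_pdivlMl// => /le_trans; apply.
    by rewrite le_eqVlt; apply/orP; left; apply/eqP; field; rewrite gt_eqF.
  rewrite (le_trans h3)// mulrDl mul1r -[_ * CQ ^+ 2 * _]mulrA -exprMn.
  rewrite (@le_trans _ _ (C0 ^+ 2 / a ^+ 4 * (CQ * `|w|) ^+ 2))//.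
    rewrite ler_wpM2l ?divr_ge0 ?exprn_ge0 ?(ltW a0) ?(ltW C0_gt0)//.
    by rewrite ler_pXn2r ?nnegrE ?mulr_ge0.
  by rewrite lerDl sqr_ge0.
- have -> : Q = dg EL ^+ 2 *m b.
    apply/matrixP => i j; rewrite ord1 -/(shunt_load b EL) shunt_loadE mxE; field.
    by rewrite gt_eqF.
  rewrite mulKmx// expr2 -mulmxE unitmx_mul dg_unit// => i; by rewrite gt_eqF.
- move=> i; rewrite mxE; have ELi := near_a _ i hEL.
  have := le_trans (coord_le_norm Q i) (ltW Q2); rewrite ler_norml => /andP[h _].
  rewrite ler_pdivlMr ?exprn_gt0//; apply: le_trans h.
  by rewrite mulNr lerN2 ler_wpM2l ?(ltW d0)// ler_pXn2r// nnegrE ltW.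
Qed.

End equilibrium.

(** * Estimates on the algebraic and differential equations *)

Section stability.
Variables (R : realType) (n m : nat) (B : 'M[R]_(n + m)).
Variables (K tau EIs : 'cV[R]_m) (T QL : 'cV[R]_n).

(** The algebraic equations divided by the load voltages: linear in EL. *)
Definition load_eq (EL : 'cV[R]_n) (EI : 'cV[R]_m) (b : 'cV[R]_n) : Prop :=
  dg b *m EL + (ulsubmx B *m EL + ursubmx B *m EI) = 0.

(** The inverter equations read tau E_I' = [E_I] (droop E_L E_I - K EIs). *)
Definition droop (EL : 'cV[R]_n) (EI : 'cV[R]_m) : 'cV[R]_m :=
  dlsubmx B *m EL + (drsubmx B + dg K) *m EI.

Lemma load_eqP EL EI b : pos_vec EL ->
  0 = shunt_load b EL + dg EL *m (ulsubmx B *m EL + ursubmx B *m EI) <->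
  load_eq EL EI b.
Proof.
move=> EL0.
have H i : (shunt_load b EL + dg EL *m (ulsubmx B *m EL + ursubmx B *m EI)) i 0
    = EL i 0 * (dg b *m EL + (ulsubmx B *m EL + ursubmx B *m EI)) i 0.
  by rewrite coordD shunt_loadE !coordE; ring.
split=> h; apply/matrixP => i j; rewrite ord1.
  apply: (mulfI (lt0r_neq0 (EL0 i))).
  by rewrite -H -h !mxE mulr0.
by rewrite H (h : _ = _) !mxE mulr0.
Qed.

Lemma closed_loopP EL EI b dEI db :
  closed_loop B K tau EIs T QL EL (EI, b) (dEI, db) <->
  [/\ pos_vec EL, pos_vec EI, load_eq EL EI b,
      forall i, tau i 0 * dEI i 0 =
                EI i 0 * (droop EL EI i 0 - K i 0 * EIs i 0)
    & forall j, T j 0 * db j 0 = QL j 0 - EL j 0 ^+ 2 * b j 0].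
Proof.
have E i : (dg tau *m dEI) i 0 = (dg EI *m dg K *m (EI - EIs) +
    dg EI *m (dlsubmx B *m EL + drsubmx B *m EI)) i 0 <->
    tau i 0 * dEI i 0 = EI i 0 * (droop EL EI i 0 - K i 0 * EIs i 0).
  have -> : (dg EI *m dg K *m (EI - EIs) +
      dg EI *m (dlsubmx B *m EL + drsubmx B *m EI)) i 0 =
      EI i 0 * (droop EL EI i 0 - K i 0 * EIs i 0).
    by rewrite -mulmxA /droop mulmxDl mulmxBr !coordE; ring.
  by rewrite dgE.
have F j : (dg T *m db) j 0 = (QL - shunt_load b EL) j 0 <->
    T j 0 * db j 0 = QL j 0 - EL j 0 ^+ 2 * b j 0.
  by rewrite !coordE shunt_loadE.
rewrite /closed_loop -[dg (col_mx EL EI) *m B *m _]mulmxA block_mul dg_col add_col_mx.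
split=> [[/pos_vec_col[hL hI] /eq_col_mx[h1 h2] h3]|[hL hI h1 h2 h3]].
  split => //; first exact/load_eqP.
    by move=> i; apply/E; rewrite h2.
  by move=> j; apply/F; rewrite h3.
split; first exact/pos_vec_col.
  congr col_mx; first exact/load_eqP.
  by apply/matrixP => i j; rewrite ord1; apply/E.
by apply/matrixP => i j; rewrite ord1; apply/F.
Qed.

Variable mu : R.
Hypothesis mu0 : 0 < mu.
Hypothesis coercive : coercive_network B K mu.

Definition load_gain : R := 2 / mu * n%:R * (m%:R * `|ursubmx B| + 1).

Lemma load_gain_ge0 : 0 <= load_gain.
Proof. by rewrite /load_gain !mulr_ge0 ?addr_ge0 ?mulr_ge0// invr_ge0 ltW. Qed.

(** Subtracting the two linear equations gives
    (B_LL + [b]) (EL - EL') = - B_LI (EI - EI') - [b - b'] EL';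
    test it with EL - EL' and use the coercivity of - (B_LL + [b]), with
    constant mu / 2. *)
Lemma load_response (EL : 'cV[R]_n) (EI : 'cV[R]_m) (b : 'cV[R]_n)
    (EL' : 'cV[R]_n) (EI' : 'cV[R]_m) (b' : 'cV[R]_n) :
  (forall i, b i 0 <= mu / 2) -> load_eq EL EI b -> load_eq EL' EI' b' ->
  `|EL - EL'| <= load_gain * (`|EI - EI'| + `|EL'| * `|b - b'|).
Proof.
move=> bmu h h'; set v := EL - EL'.
have E : (ulsubmx B + dg b) *m v =
    - (ursubmx B *m (EI - EI') + dg (b - b') *m EL').
  apply/eqP; rewrite -addr_eq0; apply/eqP.
  rewrite /load_eq in h h'.
  apply/matrixP => i j; rewrite ord1.
  move/matrixP : h => /(_ i 0); move/matrixP : h' => /(_ i 0).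
  rewrite /v mulmxDl !mulmxBr.
  rewrite !coordE [(0 : 'cV[R]_n) i 0]mxE.
  by lra.
have := load_block_coercive coercive (k := mu / 2) (b := b) v.
rewrite E => /(_ _)/le_trans/(_ (_ : _ <= n%:R * `|v| *
  (m%:R * `|ursubmx B| * `|EI - EI'| + `|EL'| * `|b - b'|))) hh.
have {}hh : mu / 2 * dot v v <= n%:R * `|v| *
    (m%:R * `|ursubmx B| * `|EI - EI'| + `|EL'| * `|b - b'|).
  apply: hh => [i|]; first by rewrite (le_trans (bmu i))//; lra.
  set s := ursubmx B *m _ + _.
  have -> : - dot v (- s) = dot v s.
    by rewrite /dot -sumrN; apply: eq_bigr => i _; rewrite [(- s) i 0]mxE mulrN opprK.
  rewrite (le_trans (dot_le_norm _ _))// ler_wpM2l ?mulr_ge0//.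
  rewrite /s (le_trans (ler_normD _ _))// lerD ?mulmx_norm_le//.
  apply/cV_norm_leP => [|i]; first by rewrite mulr_ge0.
  by rewrite dgE normrM mulrC ler_pM ?coord_le_norm.
(* Divide the quadratic estimate by |v|. *)
have [v0|v0] := eqVneq `|v| 0.
  by rewrite v0 mulr_ge0 ?load_gain_ge0// addr_ge0// mulr_ge0.
have {}v0 : 0 < `|v| by rewrite lt_neqAle eq_sym v0 normr_ge0.
have h3 : mu / 2 * `|v| <= n%:R *
    (m%:R * `|ursubmx B| * `|EI - EI'| + `|EL'| * `|b - b'|).
  rewrite -(ler_pM2r v0) [leRHS]mulrAC (le_trans _ hh)//.
  have -> : mu / 2 * `|v| * `|v| = mu / 2 * `|v| ^+ 2 by ring.
  by rewrite ler_pM2l ?norm_le_dotvv// divr_gt0.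
have -> : load_gain = (mu / 2)^-1 * (n%:R * (m%:R * `|ursubmx B| + 1)).
  by rewrite /load_gain invf_div mulrA.
rewrite -[leRHS]mulrA ler_pdivlMl ?divr_gt0// (le_trans h3)// -[leRHS]mulrA.
rewrite ler_wpM2l//.
have : 0 <= m%:R * `|ursubmx B| * (`|EL'| * `|b - b'|).
  by rewrite !mulr_ge0.
have := normr_ge0 (EI - EI'); lra.
Qed.

Variables (XL bs : 'cV[R]_n) (XI : 'cV[R]_m).
Hypotheses (XL0 : pos_vec XL) (XI0 : pos_vec XI) (bs0 : neg_vec bs).
Hypothesis bsmu : forall i, - (mu / 12) <= bs i 0.
Hypothesis eqL : load_eq XL XI bs.
Hypothesis eqI : forall i, droop XL XI i 0 = K i 0 * EIs i 0.
Hypothesis eqQ : forall j, QL j 0 = XL j 0 ^+ 2 * bs j 0.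

(** Let e_L, e_I, beta be the deviations from equilibrium,
    gamma = [EL] beta, h the droop term of (e_L, e_I), and
    l = B_LL e_L + B_LI e_I. The equations give, without remainder,
      l = - [bs] e_L - gamma,   tau e_I' = [EI] h,
      T beta' = - [EL] gamma - [bs] (EL + XL) e_L.
    Up to the factor EI / XI, close to 1, the inverter part of the derivative is
    mu / 4 times e_I . h, and by coercivity
      e_I . h <= - mu (|e_L|^2 + |e_I|^2) + e_L . gamma.
    The load part is - |gamma|^2 plus a cross term of size at most
    3 |bs| |gamma| |e_L|.
    The weight mu / 4 and the bound mu / 12 on - bs are such that both cross
    terms are absorbed by Young's inequality. *)
Lemma lyapunov_decay (EL : 'cV[R]_n) (EI : 'cV[R]_m) (b : 'cV[R]_n)
    (dEI : 'cV[R]_m) (db : 'cV[R]_n) :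
  closed_loop B K tau EIs T QL EL (EI, b) (dEI, db) ->
  (forall j, XL j 0 / 2 <= EL j 0) ->
  (forall i, `|droop (EL - XL) (EI - XI) i 0| <= mu / 4 * XI i 0) ->
  \sum_i mu / 4 * (tau i 0 / XI i 0) * ((EI - XI) i 0 * dEI i 0) +
  \sum_j T j 0 * ((b - bs) j 0 * db j 0) <=
  - (mu ^+ 2 / 8 * dot (EI - XI) (EI - XI) +
     \sum_j XL j 0 ^+ 2 / 8 * (b - bs) j 0 ^+ 2).
Proof.
move=> /closed_loopP[EL0 EI0 hL hI hQ] hEL hdroop.
set eL := EL - XL; set eI := EI - XI; set beta := b - bs.
pose h := droop eL eI.
pose l := ulsubmx B *m eL + ursubmx B *m eI.
have hE i : h i 0 = droop EL EI i 0 - K i 0 * EIs i 0.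
  rewrite -eqI /h /droop !mulmxBr.
  by rewrite !coordE; ring.
have lE j : l j 0 = - bs j 0 * eL j 0 - EL j 0 * beta j 0.
  rewrite /load_eq in hL; have eqL' := eqL; rewrite /load_eq in eqL'.
  move/matrixP : hL => /(_ j 0); move/matrixP : eqL' => /(_ j 0).
  rewrite /l /eL /eI /beta !mulmxBr !coordE [(0 : 'cV[R]_n) j 0]mxE.
  by lra.
have inv_part : \sum_i mu / 4 * (tau i 0 / XI i 0) * (eI i 0 * dEI i 0) <=
    mu / 4 * dot eI h + mu ^+ 2 / 16 * dot eI eI.
  rewrite /dot !mulr_sumr -big_split/=; apply: ler_sum => i _.
  have X0 := XI0 i.
  have -> : mu / 4 * (tau i 0 / XI i 0) * (eI i 0 * dEI i 0) =
      mu / 4 * (eI i 0 * h i 0) + mu / 4 * (eI i 0 ^+ 2 * (h i 0 / XI i 0)).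
    have -> : mu / 4 * (tau i 0 / XI i 0) * (eI i 0 * dEI i 0) =
        mu / 4 * eI i 0 * (tau i 0 * dEI i 0) / XI i 0 by ring.
    rewrite hI -hE.
    have -> : EI i 0 = eI i 0 + XI i 0 by rewrite /eI !coordE; ring.
    by field; rewrite gt_eqF.
  rewrite lerD2l -expr2.
  have -> : mu ^+ 2 / 16 * eI i 0 ^+ 2 = mu / 4 * (eI i 0 ^+ 2 * (mu / 4)) by field.
  rewrite ler_wpM2l ?divr_ge0 ?(ltW mu0)// ler_wpM2l ?sqr_ge0//.
  by rewrite ler_pdivrMr// (le_trans (ler_norm _)).
have load_part : \sum_j T j 0 * (beta j 0 * db j 0) - mu / 4 * dot eL l <=
    mu ^+ 2 / 8 * dot eL eL - \sum_j XL j 0 ^+ 2 / 8 * beta j 0 ^+ 2.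
  rewrite /dot !mulr_sumr -!sumrB/=; apply: ler_sum => j _.
  have X0 := XL0 j; have E0 := EL0 j; have XE := hEL j.
  pose g := EL j 0 * beta j 0; pose D := - bs j 0; pose x := eL j 0.
  pose k := D * (1 + XL j 0 / EL j 0).
  have D0 : 0 <= D by rewrite oppr_ge0 ltW.
  have D1 : D <= mu / 12 by rewrite lerNl.
  have k0 : 0 <= k by rewrite mulr_ge0// addr_ge0// divr_ge0// ltW.
  have k1 : k <= mu / 4.
    have : k <= mu / 12 * 3.
      rewrite ler_pM// ?addr_ge0// ?divr_ge0// ?(ltW X0) ?(ltW E0)//.
      have : XL j 0 / EL j 0 <= 2 by rewrite ler_pdivrMr//; lra.
      lra.
    lra.
  have -> : T j 0 * (beta j 0 * db j 0) = - g ^+ 2 + k * g * x.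
    rewrite mulrCA hQ eqQ /k /g /x /D.
    have -> : b j 0 = bs j 0 + beta j 0 by rewrite /beta !coordE; ring.
    have -> : eL j 0 = EL j 0 - XL j 0 by rewrite /eL !coordE; ring.
    by field; rewrite gt_eqF.
  have -> : l j 0 = D * x - g by rewrite lE.
  have -> : eL j 0 * (D * x - g) = x * (D * x - g) by [].
  have -> : eL j 0 * eL j 0 = x ^+ 2 by rewrite expr2.
  have gb : XL j 0 ^+ 2 / 8 * beta j 0 ^+ 2 <= g ^+ 2 / 2.
    have : (XL j 0 / 2) ^+ 2 * beta j 0 ^+ 2 <= EL j 0 ^+ 2 * beta j 0 ^+ 2.
      rewrite ler_wpM2r ?sqr_ge0// ler_pXn2r// nnegrE ?divr_ge0 ?(ltW X0)//.
      exact: ltW.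
    by rewrite /g exprMn; lra.
  have s1 : k * g * x <= g ^+ 2 / 4 + mu ^+ 2 / 16 * x ^+ 2.
    have := sqr_ge0 (g / 2 - k * x); have : 0 <= (mu ^+ 2 / 16 - k ^+ 2) * x ^+ 2.
      rewrite mulr_ge0 ?sqr_ge0// subr_ge0.
      have -> : mu ^+ 2 / 16 = (mu / 4) ^+ 2 by field.
      by rewrite ler_pXn2r// nnegrE// divr_ge0// ltW.
    by lra.
  have s2 : - (mu / 4 * (x * (D * x - g))) <= g ^+ 2 / 4 + mu ^+ 2 / 16 * x ^+ 2.
    have := sqr_ge0 (g / 2 - mu / 4 * x).
    have : 0 <= mu / 4 * (D * x ^+ 2).
      by rewrite mulr_ge0 ?divr_ge0 ?(ltW mu0)// mulr_ge0// sqr_ge0.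
    by lra.
  by lra.
have co : mu * (dot eL eL + dot eI eI) <= - (dot eL l + dot eI h) := coercive eL eI.
have := ler_wpM2l (ltW (divr_gt0 mu0 (ltr0n _ 4))) co.
have q1 : 0 <= mu ^+ 2 * dot eL eL by rewrite mulr_ge0 ?sqr_ge0 ?dotvv_ge0.
have q2 : 0 <= mu ^+ 2 * dot eI eI by rewrite mulr_ge0 ?sqr_ge0 ?dotvv_ge0.
rewrite !mulrDr mulrN !mulrDr !mulrA.
have -> : mu / 4 * mu = mu ^+ 2 / 4 by field.
by lra.
Qed.

End stability.

(** * Differential inequalities, antiderivatives and limits *)

Section real_functions.
Variable R : realType.
Implicit Types (f g h v : R -> R) (t c l : R).

Lemma is_derive_nincr f (df : R -> R) (a b : R) : a <= b ->
  {within `[a, b], continuous f} ->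
  (forall t, a < t < b -> is_derive t 1 f (df t) /\ df t <= 0) ->
  f b <= f a.
Proof.
move=> ab cf fdf.
have d t : t \in `]a, b[%R -> is_derive t 1 f (df t) /\ df t <= 0.
  by rewrite in_itv/=; exact: fdf.
apply: (@ler0_derive1_le_cc R f a b) => //; last 2 first.
- by rewrite in_itv/= ab lexx.
- by rewrite in_itv/= ab lexx.
- by move=> t /d[dft _].
- by move=> t /d[dft df0]; rewrite derive1E derive_val.
Qed.

Lemma is_derive_dominated g h (g' h' : R -> R) (t : R) : 0 <= t ->
  continuous g -> continuous h ->
  (forall s : R, 0 < s -> is_derive s 1 g (g' s)) ->
  (forall s : R, 0 < s -> is_derive s 1 h (h' s)) ->
  (forall s : R, 0 < s -> `|g' s| <= h' s) ->
  `|g t - g 0| <= h t - h 0.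
Proof.
move=> t0 cg ch Dg Dh gh.
have up : g t - h t <= g 0 - h 0.
  apply: (@is_derive_nincr (g - h) (g' - h')) => //.
    by apply: continuous_subspaceT => s; apply: cvgB; [exact: cg|exact: ch].
  move=> s /andP[s0 _]; have := Dg _ s0; have := Dh _ s0 => ? ?.
  split; first exact: is_deriveB.
  by rewrite subr_le0; have := gh s s0; rewrite ler_norml => /andP[].
have dn : - g t - h t <= - g 0 - h 0.
  apply: (@is_derive_nincr (- g - h) (- g' - h')) => //.
    apply: continuous_subspaceT => s; apply: cvgB; last exact: ch.
    by apply: cvgN; exact: cg.
  move=> s /andP[s0 _]; have := Dg _ s0; have := Dh _ s0 => ? ?.
  split; first by apply: is_deriveB.
  by rewrite subr_le0 lerNl; have := gh s s0; rewrite ler_norml => /andP[].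
rewrite ler_norml; lra.
Qed.

(** The decay hypothesis only holds below the level c, but v cannot leave the
    sublevel set: before the first time at which it reaches c it does not increase from
    v 0 < c. Then v t exp (l t) is nonincreasing. *)
Lemma sublevel_decay v (dv : R -> R) l c (b : R) : 0 <= l -> 0 <= b ->
  {within `[0, b], continuous v} ->
  (forall t, 0 < t < b -> is_derive t 1 v (dv t)) ->
  (forall t, 0 <= v t) ->
  (forall t, 0 < t < b -> v t < c -> dv t <= - l * v t) ->
  v 0 < c -> v b <= v 0 * expR (- l * b) /\ v b < c.
Proof.
move=> l0 b0 cv Dv v0 decay v0c.
have below t : 0 <= t <= b -> v t < c.
  move=> /andP[t0 tb]; rewrite ltNge; apply/negP => vtc.
  pose S := [set s | 0 <= s <= b /\ c <= v s].
  have Sinf : has_inf S.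
    by split; [exists t; rewrite /S/= t0 tb|exists 0 => s [/andP[]]].
  pose s := inf S.
  have s0 : 0 <= s by apply: lb_le_inf; [case: Sinf|move=> x [/andP[]]].
  have sb : s <= b.
    by rewrite (le_trans _ tb)//; apply: ge_inf; [case: Sinf|rewrite /S/= t0 tb].
  have belows x : 0 <= x < s -> v x < c.
    move=> /andP[x0 xs]; rewrite ltNge; apply/negP => vxc.
    suff : s <= x by rewrite leNgt xs.
    apply: ge_inf; first by case: Sinf.
    by rewrite /S/= x0 (ltW (lt_le_trans xs sb)).
  have vsc : v s < c.
    apply: le_lt_trans v0c; apply: (@is_derive_nincr v dv) => //.
      by apply: continuous_subspaceW cv; apply: subset_itvl; rewrite bnd_simp.
    move=> x /andP[x0 xs]; have xb : 0 < x < b by rewrite x0 (lt_le_trans xs).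
    split; first exact: Dv.
    rewrite (le_trans (decay _ xb _))//; first by apply: belows; rewrite ltW.
    by rewrite mulNr oppr_le0 mulr_ge0.
  have sI : s \in `[0, b]%classic by rewrite inE/= in_itv/= s0.
  have near_s : \forall x \near s, x \in `[0, b]%classic -> v x < c.
    have /(_ s)/= := (subspace_continuousP _ _).1 cv.
    rewrite in_itv/= s0 sb => /(_ isT).
    move=> /(_ [set y | y < c]) H.
    have {}H : \forall x \near s, `[0, b]%classic x -> v x < c := H (lt_nbhsl vsc).
    by apply: filterS H => x + xI; apply; move: xI; rewrite inE.
  have [d /= d0 hd] := near_s.
  have [x [/andP[x0 xb] vxc] xs] : exists2 x, S x & x < s + d.
    by have [x Sx xsd] := inf_adherent d0 Sinf; exists x.
  have sx : s <= x.
    by apply: ge_inf; [case: Sinf|rewrite /S/= x0 xb].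
  have : v x < c.
    apply: hd; last by rewrite inE/= in_itv/= x0.
    by rewrite /ball/= distrC ger0_norm ?subr_ge0// ltrBlDl.
  by rewrite ltNge vxc.
split; last by apply: below; rewrite b0 lexx.
have E0 t : 0 < expR (l * t) by exact: expR_gt0.
rewrite mulNr expRN -ler_pdivrMr ?invr_gt0// invrK.
pose E t := expR (l * t).
have DE t : is_derive t 1 E (l * expR (l * t)).
  rewrite mulrC; apply: (@is_derive1_comp _ expR (fun t => l * t)).
  have -> : (fun t => l * t) = l *: (id : R -> R) by [].
  by apply: is_derive_eq; rewrite /GRing.scale/= mulr1.
have -> : v 0 = (v * E) 0.
  by rewrite -[RHS]/(v 0 * expR (l * 0)) mulr0 expR0 mulr1.
rewrite -/((v * E) b).
apply: (@is_derive_nincr (v * E)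
  (fun t => v t *: (l * expR (l * t)) + expR (l * t) *: dv t)) => //.
  have cE : {within `[0, b], continuous E}.
    apply: continuous_subspaceT => t; apply: differentiable_continuous.
    by apply/derivable1_diffP; have [] := DE t.
  by move=> t; apply: cvgM; [exact: cv|exact: cE].
move=> t tb; have := DE t; have := Dv t tb => ? ?; split; first exact: is_deriveM.
have := decay t tb (below t _).
rewrite (ltW (andP tb).1) (ltW (andP tb).2) => /(_ isT) h.
have -> : v t *: (l * expR (l * t)) + expR (l * t) *: dv t =
   expR (l * t) * (dv t + l * v t) by rewrite /GRing.scale/=; ring.
by rewrite mulr_ge0_le0 ?(ltW (E0 t))//; lra.
Unshelve. all: by end_near. Qed.

(** The antiderivative is frozen for negative times, so that the
    functions built from it are continuous on the whole line while solving an
    equation for positive times only. *)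
Lemma antiderivative f : continuous f ->
  exists G : R -> R, [/\ continuous G, forall t, t <= 0 -> G t = 0
    & forall t, 0 < t -> is_derive t 1 G (f t)].
Proof.
move=> cf.
(* The base point -1 makes 0 an interior point of the interval. *)
pose F (x : R) : R := (\int[lebesgue_measure]_(t in [set` `[-1, x]]) (f t))%R.
have DF (x : R) : -1 < x -> derivable F x 1 /\ F^`() x = f x.
  move=> x1; apply: (@continuous_FTC1_closed R f (-1) x (x + 1)) => //.
  - by rewrite ltrDl.
  - apply: continuous_compact_integrable; first exact: segment_compact.
    exact: continuous_subspaceT.
  - exact: cf.
have cF : forall x : R, -1 < x -> F y @[y --> x] --> F x.
  by move=> x /DF[dF _]; apply: differentiable_continuous; apply/derivable1_diffP.
have cmax : continuous (fun t : R => Num.max t 0).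
  by apply: max_fun_continuous => t; [exact: cvg_id|exact: cvg_cst].
exists (fun t => F (Num.max t 0) - F 0); split.
- move=> t; apply: cvgB; last exact: cvg_cst.
  apply: (@continuous_comp _ _ _ (fun t => Num.max t 0) F); first exact: cmax.
  by apply: cF; rewrite lt_max ltrN10 orbT.
- by move=> t t0; rewrite max_r// subrr.
move=> t t0.
have [dF F't] : derivable F t 1 /\ F^`() t = f t.
  by apply: DF; rewrite (lt_trans _ t0)// ltrN10.
apply: (@near_eq_is_derive _ _ _ (F - cst (F 0))).
  near=> s; rewrite /GRing.add/= /GRing.opp/= max_l//.
  by apply: ltW; near: s; exact: lt_nbhsr.
have Ft : is_derive t 1 F (f t).
  by apply: DeriveDef => //; rewrite -F't derive1E.
have := is_deriveB Ft (is_derive_cst (F 0) t 1).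
by rewrite subr0.
Unshelve. all: by end_near. Qed.

Lemma le0_half_pow (x C : R) : (forall k, x <= C / 2 ^+ k) -> x <= 0.
Proof.
move=> h; rewrite leNgt; apply/negP => x0.
have C0 : 0 <= C by have := h 0%N; rewrite expr0 divr1; apply: le_trans; exact: ltW.
have := archi_boundP (divr_ge0 C0 (ltW x0)); set k := Num.bound _.
rewrite ltNge => /negP; apply; rewrite ler_pdivlMr//.
have : k%:R <= 2 ^+ k :> R by rewrite -natrX ler_nat ltnW// ltn_expl.
have := h k; rewrite ler_pdivlMr ?exprn_gt0// => h1 h2.
by rewrite (le_trans _ h1)// mulrC ler_wpM2l// ltW.
Qed.

(** The sequence a_k - 2 C / 2^k increases and stays below every
    a_j + 2 C / 2^j; the limit is its supremum. *)
Lemma half_pow_limit (a : nat -> R) C :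
  (forall k, `|a k.+1 - a k| <= C / 2 ^+ k) ->
  exists x, forall k, `|x - a k| <= 2 * C / 2 ^+ k.
Proof.
move=> ha.
have P k : 0 < (2 ^+ k : R) by rewrite exprn_gt0.
have E k : C / 2 ^+ k = 2 * (C / 2 ^+ k.+1).
  by rewrite exprS; field; rewrite gt_eqF.
pose lo k := a k - 2 * C / 2 ^+ k; pose up k := a k + 2 * C / 2 ^+ k.
have lo1 k : lo k <= lo k.+1.
  have := ha k; rewrite ler_norml /lo -!mulrA => /andP[+ _].
  by have := E k; lra.
have up1 k : up k.+1 <= up k.
  have := ha k; rewrite ler_norml /up -!mulrA => /andP[_].
  by have := E k; lra.
have lom : {homo lo : i j / (i <= j)%N >-> i <= j}.
  by apply: homo_leq => //; exact: le_trans.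
have upm : {homo up : i j / (i <= j)%N >-> j <= i}.
  by apply: homo_leq => //; [move=> y x z /[swap]; exact: le_trans].
have C0 : 0 <= C by have := ha 0%N; rewrite expr0 divr1; apply: le_trans.
have loup i j : lo i <= up j.
  apply: (le_trans (lom _ _ (leq_maxl i j))).
  apply: (le_trans _ (upm _ _ (leq_maxr i j))).
  rewrite /lo /up lerBlDr -addrA lerDl addr_ge0// divr_ge0 ?mulr_ge0//; exact: ltW.
exists (sup (range lo)) => k.
have ub j : ubound (range lo) (up j) by move=> _ [i _ <-].
have h1 : lo k <= sup (range lo).
  by apply: ub_le_sup; [exists (up 0%N); exact: ub|exists k].
have h2 : sup (range lo) <= up k by apply: ge_sup; [exists (lo 0%N), 0%N|exact: ub].
by rewrite ler_norml; move: h1 h2; rewrite /lo /up; lra.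
Qed.

End real_functions.

(** * Global solutions of Lipschitz differential equations *)

Section picard.
Variables (R : realType) (N : nat) (F : 'cV[R]_N -> 'cV[R]_N) (L : R).
Hypothesis L0 : 0 < L.
Hypothesis Flip : forall x y, `|F x - F y| <= L * `|x - y|.
Variable y0 : 'cV[R]_N.
Implicit Types a b : R -> 'cV[R]_N.

Lemma cV_continuous a : (forall i, continuous (fun t => a t i 0)) -> continuous a.
Proof.
move=> ca t; apply/cvgrPdist_le => e e0.
have : \forall s \near t, forall i, `|a t i 0 - a s i 0| <= e.
  apply: (@filter_forall R 'I_N (fun i s => `|a t i 0 - a s i 0| <= e) (nbhs t) _).
  by move=> i; have /cvgrPdist_le/(_ e e0) := ca i t.
apply: filterS => s h; apply/cV_norm_leP => [|i]; first exact: ltW.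
by rewrite !coordE.
Qed.

Lemma coord_continuous_comp a i : continuous a -> continuous (fun t => a t i 0).
Proof.
move=> ca t; apply: (@continuous_comp _ _ _ a (fun M : 'cV[R]_N => M i 0)).
  exact: ca.
exact: coord_continuous.
Qed.

(** b is the Picard iterate of a, the integral of F along a started at y0. *)
Definition picard_step a b :=
  [/\ continuous b, forall t, t <= 0 -> b t = y0
    & forall (t : R) i, 0 < t ->
        is_derive t 1 (fun s => b s i 0) (F (a t) i 0)].

Lemma picard_step_exists a : continuous a -> exists b, picard_step a b.
Proof.
move=> ca.
have cFa i : continuous (fun t => F (a t) i 0).
  move=> t; apply/cvgrPdist_le => e e0.
  have /cvgrPdist_le/(_ (e / L)) := ca t.
  rewrite divr_gt0// => /(_ isT); apply: filterS => s h.
  have := coord_le_norm (F (a t) - F (a s)) i; rewrite !coordE => /le_trans; apply.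
  by rewrite (le_trans (Flip _ _))// mulrC -ler_pdivlMr.
have /choice[G hG] i := antiderivative (cFa i).
exists (fun t => \col_i (y0 i 0 + G i t)); split.
- apply: cV_continuous => i.
  under eq_fun do rewrite mxE.
  move=> t; apply: (@cvgD _ _ _ _ _ (cst (y0 i 0)) (G i)); first exact: cvg_cst.
  by have [cG _ _] := hG i; exact: cG.
- move=> t t0; apply/matrixP => i j; rewrite mxE ord1.
  by case: (hG i) => _ -> // _; rewrite addr0.
- move=> t i t0; under eq_fun do rewrite mxE.
  have [_ _ /(_ t t0) DG] := hG i.
  by have := is_deriveD (is_derive_cst (y0 i 0) t 1) DG; rewrite add0r.
Qed.

Lemma is_derive_exp_scaled (c l t : R) :
  is_derive t 1 (fun s => c * expR (l * s)) (c * l * expR (l * t)).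
Proof.
have D1 : is_derive t 1 (fun s => l * s) l.
  have -> : (fun s => l * s) = l *: (id : R -> R) by [].
  by apply: is_derive_eq; rewrite /GRing.scale/= mulr1.
have D2 : is_derive t 1 (expR \o (fun s => l * s)) (expR (l * t) * l).
  exact: is_derive1_comp.
have -> : (fun s => c * expR (l * s)) = c *: (expR \o (fun s => l * s)) by [].
by apply: is_derive_eq; rewrite /GRing.scale/=; ring.
Qed.

Lemma continuous_exp_scaled (c l : R) : continuous (fun s => c * expR (l * s)).
Proof.
move=> t; apply: differentiable_continuous; apply/derivable1_diffP.
by have [] := is_derive_exp_scaled c l t.
Qed.

(** The weight exp (2 L t), introduced by Bielecki, makes the integral operator
    contract by 1 / 2 on the whole half line, so that the iterates converge for
    all times at once. *)
Lemma picard_step_contracts a a' b b' (c : R) : 0 <= c ->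
  picard_step a b -> picard_step a' b' ->
  (forall t, 0 < t -> `|a t - a' t| <= c * expR (2 * L * t)) ->
  forall t, 0 <= t -> `|b t - b' t| <= c / 2 * expR (2 * L * t).
Proof.
move=> c0 [cb b0 Db] [cb' b'0 Db'] haa' t t0.
apply/cV_norm_leP => [|i].
  by rewrite mulr_ge0 ?divr_ge0// ltW// expR_gt0.
have := @is_derive_dominated _ ((fun s => b s i 0) - (fun s => b' s i 0))
  (fun s => c / 2 * expR (2 * L * s))
  (fun s => F (a s) i 0 - F (a' s) i 0)
  (fun s => c / 2 * (2 * L) * expR (2 * L * s)) t t0.
rewrite /GRing.add/GRing.opp/= -/(GRing.add _ _).
have -> : b 0 i 0 = b' 0 i 0 by rewrite b0// b'0.
move=> H; rewrite !coordE.
apply: (le_trans (le_trans _ (H _ _ _ _ _))).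
- by rewrite subrr subr0.
- move=> s; apply: cvgB.
    exact: (coord_continuous_comp cb).
  exact: (coord_continuous_comp cb').
- exact: continuous_exp_scaled.
- by move=> s s0; apply: is_deriveB; [exact: Db|exact: Db'].
- by move=> s s0; exact: is_derive_exp_scaled.
- move=> s s0; have := coord_le_norm (F (a s) - F (a' s)) i.
  rewrite !coordE => /le_trans; apply; rewrite (le_trans (Flip _ _))//.
  have := ler_wpM2l (ltW L0) (haa' s s0); lra.
- by rewrite gerBl mulr_ge0 ?divr_ge0// ltW// expR_gt0.
Qed.

(** The limit v of the iterates is continuous, its own Picard iterate b is the
    solution, and b = v for nonnegative times by the contraction property. *)
Lemma picard : exists u : R -> 'cV[R]_N, [/\ continuous u, u 0 = y0
  & forall (t : R) i, 0 < t -> is_derive t 1 (fun s => u s i 0) (F (u t) i 0)].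
Proof.
have /choice[Phi hPhi] (a : R -> 'cV[R]_N) :
    exists b, continuous a -> picard_step a b.
  by have [/picard_step_exists[b]|nca] := pselect (continuous a); [exists b|exists a].
pose u k := iter k Phi (fun=> y0).
have cu k : continuous (u k).
  elim: k => [|k IH]; first by move=> t; exact: cvg_cst.
  by have [] := hPhi _ IH.
have uS k : picard_step (u k) (u k.+1) by exact: hPhi.
have u_neg k t : t <= 0 -> u k t = y0.
  by case: k => // k t0; have [_ + _] := uS k; exact.
(* With this C, the first increment is at most C exp (2 L t). *)
pose C := `|F y0| / (2 * L).
have C0 : 0 <= C by rewrite divr_ge0// ltW// mulr_gt0.
pose w (t : R) := expR (2 * L * t).
have w0 t : 0 < w t by exact: expR_gt0.
have step0 t : 0 <= t -> `|u 1 t - u 0 t| <= C * w t.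
  move=> t0; have [cu1 u10 Du1] := uS 0%N.
  apply/cV_norm_leP => [|i]; first by rewrite mulr_ge0// ltW.
  have := @is_derive_dominated _ (fun s => u 1%N s i 0)
    (fun s => C * expR (2 * L * s)) (fun=> F y0 i 0)
    (fun s => C * (2 * L) * expR (2 * L * s)) t t0.
  rewrite !coordE (u10 0 (lexx 0)) => H; apply: (le_trans (H _ _ _ _ _)).
  - exact: (coord_continuous_comp cu1).
  - exact: continuous_exp_scaled.
  - by move=> s s0; exact: is_derive_exp_scaled.
  - move=> s s0; rewrite (le_trans (coord_le_norm _ _))//.
    have -> : C * (2 * L) = `|F y0| by rewrite /C; field; rewrite gt_eqF.
    by rewrite ler_peMr// -expR0 ler_expR !mulr_ge0// ltW.
  - by rewrite gerBl mulr_ge0// ltW// expR_gt0.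
have step k t : 0 <= t -> `|u k.+1 t - u k t| <= C / 2 ^+ k * w t.
  elim: k t => [|k IH] t t0; first by rewrite expr0 divr1 step0.
  have -> : C / 2 ^+ k.+1 = C / 2 ^+ k / 2 by rewrite exprSr invfM mulrA.
  apply: (picard_step_contracts _ (uS k.+1) (uS k)) => //.
    by rewrite divr_ge0// exprn_ge0.
  by move=> s s0; apply: IH; exact: ltW.
pose w' (t : R) := w (Num.max t 0).
have w'0 t : 0 < w' t by exact: expR_gt0.
have step' k t : `|u k.+1 t - u k t| <= C * w' t / 2 ^+ k.
  rewrite /w' mulrAC; have [t0|t0] := leP 0 t; first exact: step.
  have tn := ltW t0; rewrite !u_neg// subrr normr0.
  by apply: mulr_ge0; [rewrite divr_ge0// exprn_ge0|exact: ltW].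
have /choice[v hv] (t : R) : exists x : 'cV[R]_N,
    forall k, `|x - u k t| <= 2 * (C * w' t) / 2 ^+ k.
  have /choice[x hx] (i : 'I_N) : exists x, forall k,
      `|x - u k t i 0| <= 2 * (C * w' t) / 2 ^+ k.
    apply: half_pow_limit => k; apply: le_trans (step' k t).
    by have := coord_le_norm (u k.+1 t - u k t) i; rewrite !coordE.
  exists (\col_i x i) => k; apply/cV_norm_leP => [|i].
    by rewrite divr_ge0 ?exprn_ge0// mulr_ge0// mulr_ge0// ltW.
  by rewrite !coordE mxE.
have w'mono s t : s < t + 1 -> w' s <= w' (t + 1).
  move=> st; rewrite ler_expR ler_wpM2l ?mulr_ge0 ?(ltW L0)//.
  by rewrite ge_max !le_max lexx (ltW st) orbT.
have cv : continuous v.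
  move=> t; apply/cvgrPdist_le => e e0.
  pose D := 2 * (C * w' (t + 1)).
  have D0 : 0 <= D by rewrite mulr_ge0// mulr_ge0// ltW.
  have [k hk] : exists k, D / 2 ^+ k <= e / 3.
    apply/not_existsP => H.
    have : e / 3 <= 0.
      by apply: (@le0_half_pow _ _ D) => k; rewrite leNgt; apply/negP => /ltW/H.
    by rewrite leNgt divr_gt0.
  have near_t : \forall s \near t, s < t + 1 by apply: lt_nbhsl; rewrite ltrDl.
  have := cu k t => /cvgrPdist_le/(_ (e / 3)); rewrite divr_gt0// => /(_ isT) ck.
  near=> s.
  have st1 : s < t + 1 by near: s.
  have us : `|u k t - u k s| <= e / 3 by near: s.
  have vb x : x < t + 1 -> `|v x - u k x| <= e / 3.
    move=> xt; rewrite (le_trans (hv x k))// (le_trans _ hk)//.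
    rewrite ler_wpM2r ?invr_ge0 ?exprn_ge0// ler_wpM2l// ler_wpM2l//.
    exact: w'mono.
  have -> : v t - v s = (v t - u k t) + (u k t - u k s) - (v s - u k s).
    by rewrite opprB -!addrA !addKr.
  rewrite (le_trans (ler_normB _ _))// (le_trans (lerD (ler_normD _ _) (lexx _)))//.
  have := vb t; have := vb s st1; rewrite ltrDl ltr01 => h1 /(_ isT) h2.
  lra.
have [b hb] := picard_step_exists cv.
have bv t : 0 <= t -> b t = v t.
  move=> t0; apply/eqP; rewrite -subr_eq0 -normr_le0.
  apply: (@le0_half_pow _ _ (2 * C * w t)) => k.
  have w'w s : 0 <= s -> w' s = w s by move=> s0; rewrite /w' max_l.
  have hk s : 0 < s -> `|v s - u k s| <= 2 * C / 2 ^+ k * expR (2 * L * s).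
    move=> s0; have := hv s k; rewrite w'w ?(ltW s0)// => /le_trans; apply.
    by rewrite le_eqVlt; apply/orP; left; apply/eqP; rewrite /w; ring.
  have Ck : 0 <= 2 * C / 2 ^+ k by rewrite divr_ge0 ?exprn_ge0// mulr_ge0.
  have h1 := picard_step_contracts Ck hb (uS k) hk t0.
  have h2 := hv t k.+1; rewrite w'w// in h2.
  have -> : b t - v t = (b t - u k.+1 t) - (v t - u k.+1 t).
    by rewrite opprB addrA subrK.
  rewrite (le_trans (ler_normB _ _))// (le_trans (lerD h1 h2))//.
  rewrite le_eqVlt; apply/orP; left; apply/eqP; rewrite exprS /w; field.
  by rewrite expf_neq0.
have [cb b0 Db] := hb; exists b; split => //; first exact: b0.
by move=> t i t0; rewrite bv ?ltW//; exact: Db.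
Unshelve. all: by end_near. Qed.

End picard.

(** * Derivatives in products, Lipschitz functions and clamping *)

Section pair_derivative.
Variables (R : realType) (m n : nat) (y : R -> 'cV[R]_m * 'cV[R]_n) (t : R).

Lemma derivable_pair_coord : derivable y t 1 ->
  (forall i, is_derive t 1 (fun s => (y s).1 i 0) (('D_1 y t).1 i 0)) /\
  (forall j, is_derive t 1 (fun s => (y s).2 j 0) (('D_1 y t).2 j 0)).
Proof.
move=> dy.
have H : h^-1 *: (y (h *: 1 + t) - y t) @[h --> 0^'] --> 'D_1 y t by exact: dy.
have coord p (f : 'cV[R]_m * 'cV[R]_n -> 'cV[R]_p) (i : 'I_p) :
    continuous f -> (forall k a b, f (k *: (a - b)) = k *: (f a - f b)) ->
    is_derive t 1 (fun s => f (y s) i 0) (f ('D_1 y t) i 0).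
  move=> cf linf.
  have Hf : h^-1 *: (f (y (h *: 1 + t)) i 0 - f (y t) i 0) @[h --> 0^'] -->
      f ('D_1 y t) i 0.
    have -> : (fun h : R => h^-1 *: (f (y (h *: 1 + t)) i 0 - f (y t) i 0)) =
        (fun M : 'cV[R]_p => M i 0) \o f \o
          (fun h : R => h^-1 *: (y (h *: 1 + t) - y t)).
      by apply/funext => h /=; rewrite linf !mxE.
    have K1 := cvg_comp _ _ H (cf ('D_1 y t)).
    exact: (cvg_comp _ _ K1 (@coord_continuous _ _ _ i 0 _)).
  apply: DeriveDef; first by apply/cvg_ex; exists (f ('D_1 y t) i 0).
  exact: cvg_lim Hf.
split=> [i|j].
- by apply: (coord m fst) => // z; exact: cvg_fst.
- by apply: (coord n snd) => // z; exact: cvg_snd.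
Qed.

Lemma is_derive_pair (d1 : 'cV[R]_m) (d2 : 'cV[R]_n) :
  (forall i, is_derive t 1 (fun s => (y s).1 i 0) (d1 i 0)) ->
  (forall j, is_derive t 1 (fun s => (y s).2 j 0) (d2 j 0)) ->
  derivable y t 1 /\ 'D_1 y t = (d1, d2).
Proof.
have mx p (f : R -> 'cV[R]_p) (d : 'cV[R]_p) :
    (forall i, is_derive t 1 (fun s => f s i 0) (d i 0)) ->
    h^-1 *: (f (h *: 1 + t) - f t) @[h --> 0^'] --> d.
  move=> fd; have df : derivable f t 1.
    by apply/derivable_mxP => i j; rewrite ord1; have [] := fd i.
  suff <- : 'D_1 f t = d by exact: df.
  rewrite derive_mx//; apply/matrixP => i j; rewrite mxE ord1.
  by have [] := fd i.
move=> /mx H1 /mx H2.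
have H : h^-1 *: (y (h *: 1 + t) - y t) @[h --> 0^'] --> (d1, d2).
  have -> : (fun h : R => h^-1 *: (y (h *: 1 + t) - y t)) =
      (fun h : R => (h^-1 *: ((y (h *: 1 + t)).1 - (y t).1),
                     h^-1 *: ((y (h *: 1 + t)).2 - (y t).2))).
    by apply/funext => h.
  exact: (cvg_pair H1 H2).
split; first by apply/cvg_ex; exists (d1, d2).
exact: cvg_lim H.
Qed.
End pair_derivative.

Section bounded_lipschitz.
Variables (R : realType) (X : normedModType R) (U : set X).
Implicit Types f g : X -> R.

(** Boundedness is part of the notion to make it stable under products. *)
Definition blip f := exists M : R,
  [/\ 0 <= M, forall x, U x -> `|f x| <= M
    & forall x y, U x -> U y -> `|f x - f y| <= M * `|x - y|].

Lemma blip_cst (c : R) : blip (fun=> c).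
Proof. by exists `|c|; split=> // x y _ _; rewrite subrr normr0 mulr_ge0. Qed.

Lemma blipD f g : blip f -> blip g -> blip (fun x => f x + g x).
Proof.
move=> [M [M0 fM fL]] [M' [M'0 gM gL]]; exists (M + M').
split=> [|x Ux|x y Ux Uy]; first exact: addr_ge0.
  by rewrite (le_trans (ler_normD _ _))// lerD ?fM ?gM.
rewrite opprD addrACA (le_trans (ler_normD _ _))// mulrDl.
by rewrite lerD ?fL ?gL.
Qed.

Lemma blipM f g : blip f -> blip g -> blip (fun x => f x * g x).
Proof.
move=> [M [M0 fM fL]] [M' [M'0 gM gL]].
have MM : 0 <= M * M' by exact: mulr_ge0.
exists (M * M' + M * M').
split=> [|x Ux|x y Ux Uy]; first exact: addr_ge0.
  by rewrite normrM (le_trans (ler_pM _ _ (fM _ Ux) (gM _ Ux)))// lerDl.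
have -> : f x * g x - f y * g y = f x * (g x - g y) + (f x - f y) * g y by ring.
rewrite (le_trans (ler_normD _ _))// !normrM mulrDl lerD//.
  by rewrite -mulrA ler_pM ?fM ?gL.
by rewrite mulrAC ler_pM ?fL ?gM.
Qed.

Lemma blip_sum (I : finType) (f : I -> X -> R) :
  (forall i, blip (f i)) -> blip (fun x => \sum_i f i x).
Proof.
move=> h; have -> : (fun x => \sum_i f i x) = \sum_i f i.
  by apply/funext => x; rewrite fct_sumE.
elim/big_ind : _ => //; first exact: (blip_cst 0).
by move=> ? ?; exact: blipD.
Qed.

Lemma blip_vec (p : nat) (F : X -> 'cV[R]_p) :
  (forall i, blip (fun x => F x i 0)) ->
  exists2 M : R, 0 <= M & forall x y, U x -> U y -> `|F x - F y| <= M * `|x - y|.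
Proof.
move=> /choice[M hM].
have M0 i : 0 <= M i by have [] := hM i.
have S0 : 0 <= \sum_i M i by exact: sumr_ge0.
exists (\sum_i M i) => // x y Ux Uy.
apply/cV_norm_leP => [|i]; first by rewrite mulr_ge0.
have [_ _ /(_ x y Ux Uy)] := hM i; rewrite !coordE => /le_trans; apply.
by rewrite ler_wpM2r// (bigD1 i)//= lerDl sumr_ge0.
Qed.
End bounded_lipschitz.

Section clamp.
Variables (R : realType) (N : nat) (c : 'cV[R]_N) (rho : R).
Hypothesis rho0 : 0 <= rho.

Definition clamp (z : 'cV[R]_N) : 'cV[R]_N :=
  \col_i Num.min (Num.max (z i 0) (c i 0 - rho)) (c i 0 + rho).

Lemma clamp_ball z : `|clamp z - c| <= rho.
Proof.
apply/cV_norm_leP => // i; rewrite !coordE mxE ler_norml.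
by rewrite /Num.max; do ?(case: ifPn; rewrite -?leNgt => ?);
  rewrite /Num.min; do ?(case: ifPn; rewrite -?leNgt => ?);
  have r0 : 0 <= rho := rho0; apply/andP; split; lra.
Qed.

Lemma clamp_id z : `|z - c| <= rho -> clamp z = z.
Proof.
move=> /(cV_norm_leP _ rho0) h; apply/matrixP => i j; rewrite ord1 mxE.
have := h i; rewrite !coordE ler_norml => /andP[h1 h2].
by rewrite max_l ?min_l//; lra.
Qed.

Lemma clamp_lip z z' : `|clamp z - clamp z'| <= `|z - z'|.
Proof.
apply/cV_norm_leP => // i; apply: le_trans (coord_le_norm (z - z') i).
rewrite !coordE 2!mxE.
have r0 : 0 <= rho := rho0.
have h1 := ler_norm (z i 0 - z' i 0).
have h2 : - (z i 0 - z' i 0) <= `|z i 0 - z' i 0| by rewrite -normrN ler_norm.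
rewrite ler_norml /Num.max; do ?(case: ifPn; rewrite -?leNgt => ?);
  rewrite /Num.min; do ?(case: ifPn; rewrite -?leNgt => ?);
  apply/andP; split; lra.
Qed.
End clamp.

(** * Exponential stability of the equilibrium *)

Section weighted_squares.
Variable R : realType.

Definition weighted_sq n (w : 'cV[R]_n) (v : 'cV[R]_n) : R := \sum_i w i 0 * v i 0 ^+ 2.

Lemma weighted_sq_ge0 n (w v : 'cV[R]_n) : (forall i, 0 <= w i 0) -> 0 <= weighted_sq w v.
Proof. by move=> w0; apply: sumr_ge0 => i _; rewrite mulr_ge0// sqr_ge0. Qed.

Lemma weighted_sq_lower n (w v : 'cV[R]_n) (lo : R) : 0 <= lo ->
  (forall i, lo <= w i 0) -> lo * `|v| ^+ 2 <= weighted_sq w v.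
Proof.
move=> lo0 low; rewrite (@le_trans _ _ (lo * dot v v))//.
  by rewrite ler_wpM2l// norm_le_dotvv.
rewrite /dot mulr_sumr; apply: ler_sum => i _.
by rewrite -expr2 ler_wpM2r// sqr_ge0.
Qed.

Lemma weighted_sq_upper n (w v : 'cV[R]_n) : (forall i, 0 <= w i 0) ->
  weighted_sq w v <= (\sum_i w i 0) * `|v| ^+ 2.
Proof.
move=> w0; rewrite mulr_suml; apply: ler_sum => i _.
by rewrite ler_wpM2l// -real_normK ?num_real// ler_pXn2r ?nnegrE// coord_le_norm.
Qed.

Lemma is_derive_weighted_sq n (w c : 'cV[R]_n) (y : R -> 'cV[R]_n)
    (d : 'cV[R]_n) (t : R) :
  (forall i, is_derive t 1 (fun s => y s i 0) (d i 0)) ->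
  is_derive t 1 (fun s => weighted_sq w (y s - c))
    (2 * \sum_i w i 0 * ((y t - c) i 0 * d i 0)).
Proof.
move=> yd; rewrite /weighted_sq.
have -> : (fun s => \sum_i w i 0 * (y s - c) i 0 ^+ 2) =
    \sum_i (w i 0 *: ((fun s => y s i 0) - cst (c i 0)) ^+ 2).
  apply/funext => s; rewrite fct_sumE; apply: eq_bigr => i _.
  by rewrite !coordE.
apply: is_derive_eq; rewrite mulr_sumr; apply: eq_bigr => i _.
rewrite !coordE /GRing.scale/= expr1.
rewrite subr0 -[(_ - cst _) t]/(y t i 0 - c i 0).
by ring.
Qed.

Lemma continuous_weighted_sq n (w c : 'cV[R]_n) :
  continuous (fun v : 'cV[R]_n => weighted_sq w (v - c)).
Proof.
have -> : (fun v : 'cV[R]_n => weighted_sq w (v - c)) =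
    \sum_i (fun v : 'cV[R]_n => w i 0 * ((v i 0 - c i 0) * (v i 0 - c i 0))).
  apply/funext => u; rewrite fct_sumE; apply: eq_bigr => i _.
  by rewrite !coordE expr2.
elim/big_ind : _ => [|f g cf cg|i _].
- have -> : (0 : 'cV[R]_n -> R) = cst 0 by [].
  exact: cst_continuous.
- exact: (fun v => cvgD (cf v) (cg v)).
have cc : continuous (fun v : 'cV[R]_n => v i 0) by exact: coord_continuous.
pose f (v : 'cV[R]_n) : R := v i 0.
have cf : continuous (f - cst (c i 0)).
  exact: (fun v => cvgB (cc v) (cvg_cst (c i 0))).
exact: (fun v => cvgM (cvg_cst (w i 0)) (cvgM (cf v) (cf v))).
Qed.
End weighted_squares.

Section product_norm.
Variables (R : realType) (m n : nat).

Lemma prod_norm_leP (X Y : normedModType R) (x : X * Y) (c : R) :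
  (`|x| <= c) = (`|x.1| <= c) && (`|x.2| <= c).
Proof. by rewrite prod_normE ge_max. Qed.

Lemma prod_norm1 (X Y : normedModType R) (x : X * Y) : `|x.1| <= `|x|.
Proof. by have := lexx `|x|; rewrite prod_norm_leP => /andP[]. Qed.

Lemma prod_norm2 (X Y : normedModType R) (x : X * Y) : `|x.2| <= `|x|.
Proof. by have := lexx `|x|; rewrite prod_norm_leP => /andP[]. Qed.

Lemma norm_split (z : 'cV[R]_(m + n)) : `|(usubmx z, dsubmx z)| = `|z|.
Proof.
apply/eqP; rewrite eq_le prod_norm_leP/=; apply/andP; split.
  by apply/andP; split; apply/cV_norm_leP => // i; rewrite mxE coord_le_norm.
apply/cV_norm_leP => // i; case: (split_ordP i) => k ->.
  rewrite (le_trans _ (prod_norm1 _))//= (le_trans _ (coord_le_norm _ k))//.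
  by rewrite mxE.
rewrite (le_trans _ (prod_norm2 _))//= (le_trans _ (coord_le_norm _ k))//.
by rewrite mxE.
Qed.

End product_norm.

Section equilibrium_stability.
Variables (R : realType) (n m : nat) (B : 'M[R]_(n + m)).
Variables (K tau EIs : 'cV[R]_m) (T QL : 'cV[R]_n).
Hypotheses (htau : pos_vec tau) (hT : pos_vec T).
Variable mu : R.
Hypothesis mu0 : 0 < mu.
Hypothesis coercive : coercive_network B K mu.
Variables (XL bs : 'cV[R]_n) (XI : 'cV[R]_m).
Hypotheses (XL0 : pos_vec XL) (XI0 : pos_vec XI) (bs0 : neg_vec bs).
Hypothesis bsmu : forall i, - (mu / 12) <= bs i 0.
Hypothesis eqL : load_eq B XL XI bs.
Hypothesis eqI : forall i, droop B K XL XI i 0 = K i 0 * EIs i 0.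
Hypothesis eqQ : forall j, QL j 0 = XL j 0 ^+ 2 * bs j 0.

Let CL := closed_loop B K tau EIs T QL.
Let ys : 'cV[R]_m * 'cV[R]_n := (XI, bs).

(** The factor 1 / XI compensates the factor EI of the inverter equations; the
    factor mu / 4 keeps the coupling to the loads dominated. *)
Let wI : 'cV[R]_m := \col_i (mu / 4 * (tau i 0 / XI i 0)).

Let wI0 i : 0 < wI i 0.
Proof. by rewrite mxE mulr_gt0 ?divr_gt0. Qed.

Definition lyap (y : 'cV[R]_m * 'cV[R]_n) : R :=
  weighted_sq wI (y.1 - XI) + weighted_sq T (y.2 - bs).

Lemma lyap_equiv : exists lo hi : R, [/\ 0 < lo, 0 < hi &
  forall y : 'cV[R]_m * 'cV[R]_n,
    lo * `|y - ys| ^+ 2 <= lyap y <= hi * `|y - ys| ^+ 2].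
Proof.
have [a a0 ha] := pos_vec_lb wI0; have [b b0 hb] := pos_vec_lb hT.
have SI : 0 <= \sum_i wI i 0 by apply: sumr_ge0 => i _; exact: ltW.
have ST : 0 <= \sum_i T i 0 by apply: sumr_ge0 => i _; exact: ltW.
have wI0' i : 0 <= wI i 0 by exact: ltW.
have T0' i : 0 <= T i 0 by exact: ltW.
exists (Num.min a b), (\sum_i wI i 0 + \sum_i T i 0 + 1); split.
- by rewrite lt_min a0.
- by rewrite ltr_wpDl// addr_ge0.
move=> y; have l0 : 0 <= Num.min a b by rewrite le_min !ltW.
have la i : Num.min a b <= wI i 0 by rewrite (le_trans _ (ha i))// ge_min lexx.
have lb i : Num.min a b <= T i 0 by rewrite (le_trans _ (hb i))// ge_min lexx orbT.
have [p1 p2] : `|y.1 - XI| <= `|y - ys| /\ `|y.2 - bs| <= `|y - ys|.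
  by split; [exact: (prod_norm1 (y - ys))|exact: (prod_norm2 (y - ys))].
have g1 : 0 <= weighted_sq wI (y.1 - XI) by exact: weighted_sq_ge0.
have g2 : 0 <= weighted_sq T (y.2 - bs) by exact: weighted_sq_ge0.
apply/andP; split.
  have := lexx `|y - ys|; rewrite {2}prod_normE le_max => /orP[]/= h.
    apply: le_trans (_ : weighted_sq wI (y.1 - XI) <= _); last by rewrite lerDl.
    apply: le_trans (weighted_sq_lower _ l0 la).
    by rewrite ler_wpM2l// ler_pXn2r// nnegrE.
  apply: le_trans (_ : weighted_sq T (y.2 - bs) <= _); last by rewrite lerDr.
  apply: le_trans (weighted_sq_lower _ l0 lb).
  by rewrite ler_wpM2l// ler_pXn2r// nnegrE.
have u1 : weighted_sq wI (y.1 - XI) <= (\sum_i wI i 0) * `|y - ys| ^+ 2.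
  rewrite (le_trans (weighted_sq_upper _ wI0'))// ler_wpM2l// ler_pXn2r// nnegrE//.
have u2 : weighted_sq T (y.2 - bs) <= (\sum_i T i 0) * `|y - ys| ^+ 2.
  rewrite (le_trans (weighted_sq_upper _ T0'))// ler_wpM2l// ler_pXn2r// nnegrE//.
rewrite !mulrDl mul1r (le_trans (lerD u1 u2))// lerDl sqr_ge0//.
Qed.

(** Close to equilibrium the algebraic state is controlled by the differential
    one, and the smallness assumptions of the energy estimate hold. *)
Lemma near_equilibrium : exists rho c : R, [/\ 0 < rho, 0 <= c &
  forall (EL : 'cV[R]_n) (EI : 'cV[R]_m) (b : 'cV[R]_n),
  `|(EI, b) - ys| <= rho ->
  (forall j, b j 0 <= mu / 2) /\
  (load_eq B EL EI b ->
   [/\ `|EL - XL| <= c * `|(EI, b) - ys|,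
       forall j, XL j 0 / 2 <= EL j 0, forall i, XI i 0 / 2 <= EI i 0
     & forall i, `|droop B K (EL - XL) (EI - XI) i 0| <= mu / 4 * XI i 0])].
Proof.
have [aL aL0 haL] := pos_vec_lb XL0; have [aI aI0 haI] := pos_vec_lb XI0.
pose c : R := load_gain B mu * (1 + `|XL|).
have c0 : 0 <= c by rewrite mulr_ge0 ?load_gain_ge0// addr_ge0.
pose D : R := n%:R * `|dlsubmx B| * c + m%:R * `|drsubmx B + dg K|.
have D0 : 0 <= D.
  by apply: addr_ge0; [apply: mulr_ge0 => //; exact: mulr_ge0|exact: mulr_ge0].
pose rho : R := Num.min (Num.min (mu / 2) (aI / 2))
  (Num.min (aL / 2 / (c + 1)) (mu / 4 * aI / (D + 1))).
have c1 : 0 < c + 1 by rewrite ltr_wpDl.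
have D1 : 0 < D + 1 by rewrite ltr_wpDl.
have rho0 : 0 < rho.
  rewrite !lt_min; apply/andP; split; apply/andP; split;
    by rewrite ?divr_gt0 ?mulr_gt0 ?divr_gt0.
exists rho, c; split=> // EL EI b; set d := `|_ - ys|.
rewrite !le_min => /andP[/andP[r1 r2] /andP[]].
rewrite !ler_pdivlMr// => r3 r4.
have d0 : 0 <= d by exact: normr_ge0.
have dI : `|EI - XI| <= d by exact: (prod_norm1 ((EI, b) - ys)).
have db : `|b - bs| <= d by exact: (prod_norm2 ((EI, b) - ys)).
have bmu j : b j 0 <= mu / 2.
  have := le_trans (coord_le_norm (b - bs) j) db; rewrite !coordE ler_norml => /andP[_].
  by have := bs0 j; lra.
split=> // hL.
have resp : `|EL - XL| <= c * d.
  rewrite (le_trans (load_response mu0 coercive bmu hL eqL))//.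
  rewrite /c -mulrA ler_wpM2l ?load_gain_ge0// mulrDl mul1r lerD//.
  by rewrite ler_wpM2l.
have cd : c * d <= d * (c + 1) by rewrite mulrDr mulr1 mulrC lerDl.
split=> //.
- move=> j; have := le_trans (coord_le_norm (EL - XL) j) resp.
  by rewrite !coordE ler_norml => /andP[h _]; have := haL j; lra.
- move=> i; have := le_trans (coord_le_norm (EI - XI) i) dI.
  by rewrite !coordE ler_norml => /andP[h _]; have := haI i; lra.
- move=> i; rewrite (le_trans (coord_le_norm _ i))//.
  rewrite /droop (le_trans (ler_normD _ _))//.
  rewrite (le_trans (lerD (mulmx_norm_le _ _) (mulmx_norm_le _ _)))//.
  apply: (@le_trans _ _ (D * d)).
    rewrite /D mulrDl lerD ?ler_wpM2l ?mulr_ge0//.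
    by rewrite -[leRHS]mulrA ler_wpM2l ?mulr_ge0.
  apply: (@le_trans _ _ (mu / 4 * aI)).
    by rewrite (le_trans _ r4)// mulrDr mulr1 mulrC lerDl.
  by rewrite ler_wpM2l// divr_ge0// ltW.
Qed.

(** The derivative of lyap at y in the direction (dEI, db). *)
Definition lyap_rate (y : 'cV[R]_m * 'cV[R]_n) (dEI : 'cV[R]_m)
    (db : 'cV[R]_n) : R :=
  2 * \sum_i wI i 0 * ((y.1 - XI) i 0 * dEI i 0) +
  2 * \sum_j T j 0 * ((y.2 - bs) j 0 * db j 0).

Lemma lyap_rate_le : exists2 lam : R, 0 < lam &
  forall EL EI b dEI db, CL EL (EI, b) (dEI, db) ->
  (forall j, XL j 0 / 2 <= EL j 0) ->
  (forall i, `|droop B K (EL - XL) (EI - XI) i 0| <= mu / 4 * XI i 0) ->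
  lyap_rate (EI, b) dEI db <= - lam * lyap (EI, b).
Proof.
pose vI : 'cV[R]_m := \col_i (mu ^+ 2 / 4 / wI i 0).
pose vL : 'cV[R]_n := \col_j (XL j 0 ^+ 2 / 4 / T j 0).
have [|a a0 ha] := @pos_vec_lb _ _ vI.
  by move=> i; rewrite mxE !divr_gt0// exprn_gt0.
have [|b b0 hb] := @pos_vec_lb _ _ vL.
  by move=> i; rewrite mxE !divr_gt0// exprn_gt0.
exists (Num.min a b); first by rewrite lt_min a0.
move=> EL EI bb dEI db hCL h1 h2.
have := lyapunov_decay mu0 coercive XL0 XI0 bs0 bsmu eqL eqI eqQ hCL h1 h2.
rewrite /lyap_rate -mulrDr.
have -> : \sum_i mu / 4 * (tau i 0 / XI i 0) * ((EI - XI) i 0 * dEI i 0) =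
   \sum_i wI i 0 * ((EI - XI) i 0 * dEI i 0).
  by apply: eq_bigr => i _; rewrite [wI i 0]mxE.
move=> h; have {h} := ler_wpM2l (ler0n R 2) h => /le_trans; apply.
rewrite mulrN mulNr lerN2 /lyap !mulrDr lerD//.
  rewrite /weighted_sq /dot 3!mulr_sumr; apply: ler_sum => i _.
  have := ha i; rewrite mxE ler_pdivlMr// => hi.
  have : Num.min a b * wI i 0 <= mu ^+ 2 / 4.
    by rewrite (le_trans _ hi)// ler_wpM2r ?(ltW (wI0 i))// ge_min lexx.
  move=> /(ler_wpM2r (sqr_ge0 ((EI - XI) i 0))) => {}hi; rewrite [leLHS]mulrA.
  by apply: (le_trans hi); rewrite le_eqVlt; apply/orP; left; apply/eqP; field.
rewrite /weighted_sq 2!mulr_sumr; apply: ler_sum => i _.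
have := hb i; rewrite mxE ler_pdivlMr// => hi.
have : Num.min a b * T i 0 <= XL i 0 ^+ 2 / 4.
  by rewrite (le_trans _ hi)// ler_wpM2r ?(ltW (hT i))// ge_min lexx orbT.
move=> /(ler_wpM2r (sqr_ge0 ((bb - bs) i 0))) => {}hi; rewrite [leLHS]mulrA.
by apply: (le_trans hi); rewrite le_eqVlt; apply/orP; left; apply/eqP; field.
Qed.

Lemma lyap_ge0 y : 0 <= lyap y.
Proof. by apply: addr_ge0; apply: weighted_sq_ge0 => i; exact: ltW. Qed.

Lemma is_derive_lyap (y : R -> 'cV[R]_m * 'cV[R]_n) (dEI : 'cV[R]_m)
    (db : 'cV[R]_n) (t : R) :
  (forall i, is_derive t 1 (fun s => (y s).1 i 0) (dEI i 0)) ->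
  (forall j, is_derive t 1 (fun s => (y s).2 j 0) (db j 0)) ->
  is_derive t 1 (fun s => lyap (y s)) (lyap_rate (y t) dEI db).
Proof.
move=> h1 h2; have d1 := is_derive_weighted_sq wI XI h1.
have d2 := is_derive_weighted_sq T bs h2.
exact: is_deriveD.
Qed.

Lemma continuous_lyap : continuous lyap.
Proof.
have c1 : continuous (fun y : 'cV[R]_m * 'cV[R]_n => weighted_sq wI (y.1 - XI)).
  exact: (fun y => continuous_comp (@cvg_fst _ _ _ _ _)
    (@continuous_weighted_sq _ _ wI XI y.1)).
have c2 : continuous (fun y : 'cV[R]_m * 'cV[R]_n => weighted_sq T (y.2 - bs)).
  exact: (fun y => continuous_comp (@cvg_snd _ _ _ _ _)
    (@continuous_weighted_sq _ _ T bs y.2)).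
exact: (fun y => cvgD (c1 y) (c2 y)).
Qed.

Let zs : 'cV[R]_(m + n) := col_mx XI bs.

(** The solution of the algebraic equations. The differential state (EI, b) is
    stacked in one column, the form in which the initial value problem is
    solved. *)
Definition load_voltage (z : 'cV[R]_(m + n)) : 'cV[R]_n :=
  - (invmx (ulsubmx B + dg (dsubmx z)) *m (ursubmx B *m usubmx z)).

Lemma load_block_unit (b : 'cV[R]_n) : (forall j, b j 0 <= mu / 2) ->
  ulsubmx B + dg b \in unitmx.
Proof.
move=> bmu; apply: (@coercive_unitmx _ _ _ (mu / 2)); first by rewrite divr_gt0.
move=> v; apply: (load_block_coercive coercive) => j.
by rewrite (le_trans (bmu j))//; lra.
Qed.

Lemma load_voltage_eq z : (forall j, dsubmx z j 0 <= mu / 2) ->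
  load_eq B (load_voltage z) (usubmx z) (dsubmx z).
Proof.
move=> bmu; rewrite /load_eq addrA -mulmxDl [dg _ + _]addrC /load_voltage mulmxN.
by rewrite mulKVmx ?load_block_unit// addNr.
Qed.

Lemma load_eq_unique (EL : 'cV[R]_n) (EI : 'cV[R]_m) (b : 'cV[R]_n) :
  (forall j, b j 0 <= mu / 2) ->
  load_eq B EL EI b -> EL = load_voltage (col_mx EI b).
Proof.
move=> bmu h; have h' := @load_voltage_eq (col_mx EI b).
rewrite col_mxKu col_mxKd in h'.
have := load_response mu0 coercive bmu h (h' bmu).
rewrite !subrr !normr0 mulr0 addr0 mulr0 normr_le0 subr_eq0.
by move=> /eqP.
Qed.

Definition field (z : 'cV[R]_(m + n)) : 'cV[R]_(m + n) :=
  col_mx (\col_i (usubmx z i 0 *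
            (droop B K (load_voltage z) (usubmx z) i 0 - K i 0 * EIs i 0) / tau i 0))
         (\col_j ((QL j 0 - load_voltage z j 0 ^+ 2 * dsubmx z j 0) / T j 0)).

Lemma field_closed_loop z : (forall j, dsubmx z j 0 <= mu / 2) ->
  pos_vec (load_voltage z) -> pos_vec (usubmx z) ->
  CL (load_voltage z) (usubmx z, dsubmx z) (usubmx (field z), dsubmx (field z)).
Proof.
move=> bmu pL pI; apply/closed_loopP; split => //; first exact: load_voltage_eq.
  by move=> i; rewrite col_mxKu [X in _ * X = _]mxE mulrC divfK// gt_eqF.
by move=> j; rewrite col_mxKd [X in _ * X = _]mxE mulrC divfK// gt_eqF.
Qed.

Lemma blip_mulmx (U : set 'cV[R]_(m + n)) p q (A : 'M[R]_(p, q))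
    (v : 'cV[R]_(m + n) -> 'cV[R]_q) i :
  (forall k, blip U (fun z => v z k 0)) -> blip U (fun z => (A *m v z) i 0).
Proof.
move=> hv; under eq_fun do rewrite mxE.
by apply: blip_sum => k; apply: blipM => //; exact: blip_cst.
Qed.

(** The load voltages are Lipschitz by load_response, and the field is a
    polynomial in them and in the state. *)
Lemma field_lipschitz (rho c : R) : 0 < rho -> 0 <= c ->
  (forall (EL : 'cV[R]_n) (EI : 'cV[R]_m) (b : 'cV[R]_n),
    `|(EI, b) - ys| <= rho ->
    (forall j, b j 0 <= mu / 2) /\
    (load_eq B EL EI b -> `|EL - XL| <= c * `|(EI, b) - ys|)) ->
  exists2 M : R, 0 <= M & forall z z' : 'cV[R]_(m + n),
    `|z - zs| <= rho -> `|z' - zs| <= rho ->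
    `|load_voltage z - load_voltage z'| <= M * `|z - z'| /\
    `|field z - field z'| <= M * `|z - z'|.
Proof.
move=> rho0 c0 near; pose U : set 'cV[R]_(m + n) := [set z | `|z - zs| <= rho].
have pairE (z z' : 'cV[R]_(m + n)) : (usubmx z, dsubmx z) - (usubmx z', dsubmx z') =
    (usubmx (z - z'), dsubmx (z - z')) :> 'cV[R]_m * 'cV[R]_n.
  by rewrite !linearB.
have ysE : ys = (usubmx zs, dsubmx zs) by rewrite /zs col_mxKu col_mxKd.
have nearz (z : 'cV[R]_(m + n)) : U z -> (forall j, dsubmx z j 0 <= mu / 2) /\
    `|load_voltage z - XL| <= c * rho.
  move=> Uz; have Uz' : `|(usubmx z, dsubmx z) - ys| <= rho.
    by rewrite ysE pairE norm_split.
  have [bmu h] := near (load_voltage z) _ _ Uz'; split=> //.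
  rewrite (le_trans (h _))//; first exact: load_voltage_eq.
  by rewrite ler_wpM2l.
pose M1 : R := `|XL| + c * rho.
have M10 : 0 <= M1 by rewrite addr_ge0// mulr_ge0// ltW.
have lvM (z : 'cV[R]_(m + n)) : U z -> `|load_voltage z| <= M1.
  move=> /nearz[_ h]; rewrite -[load_voltage z](subrK XL) addrC.
  by rewrite (le_trans (ler_normD _ _))// lerD2l.
have subM (z z' : 'cV[R]_(m + n)) : `|usubmx z - usubmx z'| <= `|z - z'| /\
    `|dsubmx z - dsubmx z'| <= `|z - z'|.
  have := norm_split (z - z'); rewrite -pairE => <-.
  by split; [exact: (prod_norm1 ((_, _) - (_, _)))
            |exact: (prod_norm2 ((_, _) - (_, _)))].
pose M2 : R := load_gain B mu * (1 + M1).
have M20 : 0 <= M2 by rewrite mulr_ge0 ?load_gain_ge0// addr_ge0.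
have lvL (z z' : 'cV[R]_(m + n)) : U z -> U z' ->
    `|load_voltage z - load_voltage z'| <= M2 * `|z - z'|.
  move=> Uz Uz'; have [bz _] := nearz z Uz; have [bz' _] := nearz z' Uz'.
  have := load_response mu0 coercive bz (load_voltage_eq bz) (load_voltage_eq bz').
  move=> /le_trans; apply; rewrite /M2 -mulrA ler_wpM2l ?load_gain_ge0//.
  have [h1 h2] := subM z z'; rewrite mulrDl mul1r lerD//.
  by rewrite ler_pM// lvM.
have blv j : blip U (fun z => load_voltage z j 0).
  exists (Num.max M1 M2); split; first by rewrite le_max M10.
    by move=> z Uz; rewrite (le_trans (coord_le_norm _ _))// le_max lvM.
  move=> z z' Uz Uz'.
  have := coord_le_norm (load_voltage z - load_voltage z') j.
  rewrite !coordE => /le_trans; apply; rewrite (le_trans (lvL _ _ Uz Uz'))//.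
  by rewrite ler_wpM2r// le_max lexx orbT.
have bz k : blip U (fun z => z k 0).
  exists (Num.max 1 (`|zs| + rho)); split; first by rewrite le_max ler01.
    move=> z Uz; have zb : `|z| <= `|zs| + rho.
      by rewrite -[z](subrK zs) addrC (le_trans (ler_normD _ _))// lerD2l.
    by rewrite (le_trans (coord_le_norm _ _))// le_max zb orbT.
  move=> z z' Uz Uz'; have := coord_le_norm (z - z') k.
  rewrite !coordE => /le_trans; apply.
  by rewrite ler_peMl// le_max lexx.
have bu i : blip U (fun z => usubmx z i 0).
  by under eq_fun do rewrite mxE; exact: bz.
have bd j : blip U (fun z => dsubmx z j 0).
  by under eq_fun do rewrite mxE; exact: bz.
have bdroop i : blip U (fun z => droop B K (load_voltage z) (usubmx z) i 0).
  under eq_fun do rewrite /droop coordD.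
  by apply: blipD; apply: blip_mulmx.
have [M M0 hM] : exists2 M : R, 0 <= M & forall z z' : 'cV[R]_(m + n), U z -> U z' ->
    `|field z - field z'| <= M * `|z - z'|.
  apply: blip_vec => i; rewrite /field; case: (split_ordP i) => k ->.
    under eq_fun do rewrite col_mxEu mxE.
    apply: blipM; last exact: blip_cst.
    apply: blipM => //; apply: blipD => //; exact: blip_cst.
  under eq_fun do rewrite col_mxEd mxE -mulrN expr2.
  apply: blipM; last exact: blip_cst.
  apply: blipD; first exact: blip_cst.
  apply: blipM; first exact: blipM.
  under eq_fun do rewrite -mulN1r.
  by apply: blipM => //; exact: blip_cst.
exists (Num.max M2 M) => [|z z' Uz Uz']; first by rewrite le_max M20.
split.
  by rewrite (le_trans (lvL _ _ Uz Uz'))// ler_wpM2r// le_max lexx.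
by rewrite (le_trans (hM _ _ Uz Uz'))// ler_wpM2r// le_max lexx orbT.
Qed.

(** Below the level lev of lyap the state is in the ball of radius rho, where
    lyap decays, so that sublevel_decay applies to every solution (trap). For
    existence, the vector field is precomposed with the projection onto that
    ball; the solution of this globally Lipschitz equation stays in the ball by
    the same argument, hence solves the original one. The load voltages follow
    algebraically in both parts. *)
Lemma exponential_stability : locally_exponentially_stable CL XL ys.
Proof.
have [rho [c [rho0 c0 near]]] := near_equilibrium.
have [lo [hi [lo0 hi0 eqv]]] := lyap_equiv.
have [lam lam0 rate] := lyap_rate_le.
pose lev : R := lo * rho ^+ 2.
pose q : R := Num.sqrt (lo / hi).
have q0 : 0 < q by rewrite sqrtr_gt0 divr_gt0.
have q2 : q ^+ 2 = lo / hi by rewrite sqr_sqrtr// divr_ge0// ltW.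
have small_ball y : lyap y < lev -> `|y - ys| <= rho.
  move=> hy; have /andP[h _] := eqv y.
  have := le_lt_trans h hy; rewrite ltr_pM2l// ltr_pXn2r ?nnegrE ?(ltW rho0)//.
  exact: ltW.
have trap (y : R -> 'cV[R]_m * 'cV[R]_n) (x : R -> 'cV[R]_n)
    (d1 : R -> 'cV[R]_m) (d2 : R -> 'cV[R]_n) (b : R) : 0 <= b ->
    {within `[0, b], continuous y} ->
    (forall t i, 0 < t < b -> is_derive t 1 (fun s => (y s).1 i 0) (d1 t i 0)) ->
    (forall t j, 0 < t < b -> is_derive t 1 (fun s => (y s).2 j 0) (d2 t j 0)) ->
    (forall t, 0 < t < b -> lyap (y t) < lev -> CL (x t) (y t) (d1 t, d2 t)) ->
    lyap (y 0) < lev ->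
    lyap (y b) <= lyap (y 0) * expR (- lam * b) /\ lyap (y b) < lev.
  move=> b0 cy D1 D2 hCL y0lev.
  apply: (@sublevel_decay R (fun t => lyap (y t))
    (fun t => lyap_rate (y t) (d1 t) (d2 t))) => //.
  - exact: ltW.
  - move=> t; apply: (@continuous_comp (subspace `[0, b]%classic) _ _ y lyap).
      exact: cy.
    exact: continuous_lyap.
  - by move=> t tb; apply: is_derive_lyap => k; [exact: D1|exact: D2].
  - by move=> t; exact: lyap_ge0.
  - move=> t tb ylev; have := hCL t tb ylev; have := small_ball _ ylev.
    case: (y t) => EI b' /(near (x t))[_ h] hcl.
    have [_ _ /h[_ h2 _ h4] _ _] := (closed_loopP _ _ _ _ _ _ _ _ _ _ _).1 hcl.
    exact: rate hcl h2 h4.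
have exp_bound (y0 y : 'cV[R]_m * 'cV[R]_n) (t : R) :
    lyap y <= lyap y0 * expR (- lam * t) ->
    `|y - ys| <= q^-1 * expR (- (lam / 2) * t) * `|y0 - ys|.
  move=> h; have /andP[h1 _] := eqv y; have /andP[_ h2] := eqv y0.
  have E0 : 0 <= q^-1 * expR (- (lam / 2) * t) * `|y0 - ys|.
    by rewrite !mulr_ge0 ?invr_ge0 ?expR_ge0// ltW.
  rewrite -(@ler_pXn2r _ 2)// ?nnegrE// !exprMn exprVn q2 invf_div.
  have -> : expR (- (lam / 2) * t) ^+ 2 = expR (- lam * t).
    by rewrite expr2 -expRD; congr expR; field.
  rewrite -(ler_pM2l lo0) (le_trans h1)// (le_trans h)//.
  have -> : lo * (hi / lo * expR (- lam * t) * `|y0 - ys| ^+ 2) =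
      hi * `|y0 - ys| ^+ 2 * expR (- lam * t) by field; rewrite gt_eqF.
  by rewrite ler_wpM2r// expR_ge0.
(* hi (rho q)^2 = lev: the ball of radius rho q lies below the level. *)
exists (rho * q), ((c + 1) * q^-1), (lam / 2); split.
- exact: mulr_gt0.
- by rewrite mulr_gt0 ?invr_gt0// ltr_wpDl.
- by rewrite divr_gt0.
move=> x0 y0 [dy0 S0] near0.
have y0q : `|y0 - ys| < rho * q.
  by apply: le_lt_trans near0; exact: (prod_norm2 (x0 - XL, y0 - ys)).
have y0lev : lyap y0 < lev.
  have /andP[_ h] := eqv y0; rewrite (le_lt_trans h)//.
  have -> : lev = hi * (rho * q) ^+ 2.
    by rewrite exprMn q2 /lev; field; rewrite gt_eqF.
  by rewrite ltr_pM2l// ltr_pXn2r// nnegrE// mulr_ge0// ltW.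
split; last first.
  move=> t1 x y [cx cy sol] x00 y00 t t0 tt1.
  have cyt : {within `[0, t], continuous y}.
    apply: continuous_subspaceW cy => s /=; rewrite in_itv/= => /andP[s0 st].
    by split=> //; apply: le_lt_trans tt1; rewrite lee_fin.
  have sol' s : 0 < s < t -> derivable y s 1 /\ CL (x s) (y s) ('D_1 y s).
    move=> /andP[s0 st]; apply: sol => //.
    by apply: lt_trans tt1; rewrite lte_fin.
  have [bound ytlev] : lyap (y t) <= lyap (y 0) * expR (- lam * t) /\ lyap (y t) < lev.
    apply: (trap y x (fun s => ('D_1 y s).1) (fun s => ('D_1 y s).2)) => //.
    - by move=> s i /sol'[/derivable_pair_coord[+ _] _]; apply.
    - by move=> s i /sol'[/derivable_pair_coord[_ +] _]; apply.
    - by move=> s /sol'[_ +] _; case: ('D_1 y s).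
    - by rewrite y00.
  have [dy Sdy] : exists dy, CL (x t) (y t) dy.
    move: t0; rewrite le_eqVlt => /predU1P[<-|t0]; first by rewrite x00 y00; exists dy0.
    by have [_ h] := sol t t0 tt1; exists ('D_1 y t).
  have xt : `|x t - XL| <= c * `|y t - ys|.
    move: Sdy (small_ball _ ytlev); case: (y t) => EI b; case: dy => dEI db hcl.
    move=> /(near (x t))[_ h].
    by have [_ _ /h[]] := (closed_loopP _ _ _ _ _ _ _ _ _ _ _).1 hcl.
  rewrite y00 in bound; have := exp_bound _ _ _ bound => yt.
  have N0 : 0 <= `|y t - ys| by exact: normr_ge0.
  apply: (@le_trans _ _ ((c + 1) * `|y t - ys|)).
    rewrite prod_norm_leP/= mulrDl mul1r; apply/andP; split.
      by rewrite (le_trans xt)// lerDl.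
    by rewrite lerDr mulr_ge0.
  rewrite -!mulrA ler_wpM2l ?addr_ge0// (le_trans yt)// -mulrA.
  rewrite ler_wpM2l ?invr_ge0 ?(ltW q0)// ler_wpM2l ?expR_ge0//.
  exact: (prod_norm2 (x0 - XL, y0 - ys)).
have [|M M0 lip] := field_lipschitz rho0 c0.
  by move=> EL EI b /(near EL)[h1 h2]; split=> // /h2[].
have ysE : ys = (usubmx zs, dsubmx zs) by rewrite /zs col_mxKu col_mxKd.
have ballE (z : 'cV[R]_(m + n)) : `|(usubmx z, dsubmx z) - ys| = `|z - zs|.
  by rewrite -norm_split ysE !linearB.
pose cl := clamp zs rho.
have clball z : `|cl z - zs| <= rho by exact/clamp_ball/ltW.
have clid z : `|z - zs| <= rho -> cl z = z by apply/clamp_id/ltW.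
have cllip z z' : `|cl z - cl z'| <= `|z - z'| by exact/clamp_lip/ltW.
pose F z := field (cl z).
have L0 : 0 < M + 1 by rewrite ltr_wpDl.
have Flip (z z' : 'cV[R]_(m + n)) : `|F z - F z'| <= (M + 1) * `|z - z'|.
  have [_ h] := lip _ _ (clball z) (clball z').
  rewrite (le_trans h)// ler_pM//; last by rewrite lerDl.
have [u [cu u0 Du]] := picard L0 Flip (col_mx y0.1 y0.2).
pose y t := (usubmx (u t), dsubmx (u t)).
have cy : continuous y.
  have c1 : continuous (fun t => usubmx (u t)).
    apply: cV_continuous => i; under eq_fun do rewrite mxE.
    exact: coord_continuous_comp.
  have c2 : continuous (fun t => dsubmx (u t)).
    apply: cV_continuous => i; under eq_fun do rewrite mxE.
    exact: coord_continuous_comp.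
  exact: (fun t => cvg_pair (c1 t) (c2 t)).
have y_0 : y 0 = y0.
  by rewrite /y u0 col_mxKu col_mxKd; case: (y0).
pose x t := load_voltage (cl (u t)).
have D1 (t : R) i : 0 < t ->
    is_derive t 1 (fun s => (y s).1 i 0) (usubmx (F (u t)) i 0).
  by move=> t0; rewrite mxE /y/=; under eq_fun do rewrite mxE; exact: Du.
have D2 (t : R) i : 0 < t ->
    is_derive t 1 (fun s => (y s).2 i 0) (dsubmx (F (u t)) i 0).
  by move=> t0; rewrite mxE /y/=; under eq_fun do rewrite mxE; exact: Du.
have CLu (t : R) : lyap (y t) < lev ->
    CL (x t) (y t) (usubmx (F (u t)), dsubmx (F (u t))).
  move=> /small_ball h; have [bmu hL] := near (x t) _ _ h.
  have uid : cl (u t) = u t by apply: clid; rewrite -ballE.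
  rewrite /x uid in hL *; rewrite /F uid; have lv := load_voltage_eq bmu.
  have [_ h1 h2 _] := hL lv.
  apply: field_closed_loop => // k.
    by apply: lt_le_trans (h1 k); rewrite divr_gt0.
  by apply: lt_le_trans (h2 k); rewrite divr_gt0.
have ulev (t : R) : 0 <= t -> lyap (y t) < lev.
  move=> t0; have h0 : lyap (y 0) < lev by rewrite y_0.
  have cyt : {within `[0, t], continuous y} by exact: continuous_subspaceT.
  have [_ //] := trap y x (fun s => usubmx (F (u s))) (fun s => dsubmx (F (u s)))
    t t0 cyt (fun s i st => D1 s i (proj1 (andP st)))
    (fun s i st => D2 s i (proj1 (andP st))) (fun s _ => CLu s) h0.
exists x, y; split => //.
  split.
  - apply: continuous_subspaceT => t; apply/cvgrPdist_le => e e0.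
    have /cvgrPdist_le/(_ (e / (M + 1))) := cu t.
    rewrite divr_gt0// => /(_ isT); apply: filterS => s h.
    have [h' _] := lip _ _ (clball (u t)) (clball (u s)).
    rewrite /x (le_trans h')// (@le_trans _ _ ((M + 1) * `|u t - u s|))//.
      by rewrite ler_pM// lerDl.
    by rewrite mulrC -ler_pdivlMr.
  - exact: continuous_subspaceT.
  - move=> t t0 _.
    have [dy Dy] := is_derive_pair (fun i => D1 t i t0) (fun i => D2 t i t0).
    by split=> //; rewrite Dy; apply/CLu/ulev/ltW.
move: y_0 S0 y0lev; rewrite /x u0; case: (y0) => EI0 b0 /= _ S0 lev0.
case: dy0 S0 => dEI0 db0 /closed_loopP[_ _ hL _ _].
have h := small_ball _ lev0; have [bmu _] := near x0 _ _ h.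
rewrite clid; first exact/esym/load_eq_unique.
by rewrite -ballE col_mxKu col_mxKd.
Qed.

End equilibrium_stability.

Theorem mainTheorem5 (R : realType) (n m : nat) (hn : (1 <= n)%N)
    (hm : (1 <= m)%N)
    (e : rel 'I_(n + m)) (he : connected_graph e)
    (B : 'M[R]_(n + m)) (hB : susceptance_matrix e B)
    (K tau EIs : 'cV[R]_m)
    (hK : neg_vec K) (htau : pos_vec tau) (hEIs : pos_vec EIs)
    (T : 'cV[R]_n) (hT : pos_vec T) :
  exists delta C r : R, [/\ 0 < delta, 0 < C, 0 < r &
    forall QL : 'cV[R]_n, neg_vec QL -> `|QL| < delta ->
    exists EL b : 'cV[R]_n,
      [/\ DS_solution B K EIs QL EL b /\ `|EL - ELstar B K EIs| < r,
          forall EL' b' : 'cV[R]_n,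
            DS_solution B K EIs QL EL' b' -> `|EL' - ELstar B K EIs| < r ->
            EL' = EL /\ b' = b,
          exists epsilon : 'cV[R]_n,
            EL = dg (ELstar B K EIs) *m
                   (const_mx 1 - invmx (Qsc B K EIs) *m QL + epsilon) /\
            `|epsilon| <= C * `|invmx (Qsc B K EIs) *m QL| ^+ 2,
          b = invmx (dg EL ^+ 2) *m QL
        & let EI := W2 B K *m col_mx EL EIs in
          dae_equilibrium (closed_loop B K tau EIs T QL) EL (EI, b) /\
          locally_exponentially_stable
            (closed_loop B K tau EIs T QL) EL (EI, b)]].
Proof.
have [mu mu0 coer] := power_network_coercive hm he hB hK.
have mu12 : 0 < mu / 12 by rewrite divr_gt0.
have [delta [C [r [delta0 C0 r0 sols]]]] := DS_solution_exists hm he hB hK hEIs mu12.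
exists delta, C, r; split => // QL Q0 Qdelta.
have [EL [b [sol uniq expansion bE blow]]] := sols QL Q0 Qdelta.
exists EL, b; split => //; set EI := W2 B K *m _.
have [[EL0 b0 rpf hQ] _] := sol.
have eqL : load_eq B EL EI b.
  apply/load_eqP => //; rewrite (load_balance mu0 coer EIs EL) mulmxA.
  exact: rpf.
have hI : dlsubmx B *m EL + drsubmx B *m EI + dg K *m EI = dg K *m EIs.
  exact: inverter_balance mu0 coer EIs EL.
have [_ EI0] : pos_vec EL /\ pos_vec EI.
  by apply: (network_voltages_pos hm he hB hK hEIs _ eqL hI) => i; exact: ltW.
have eqI i : droop B K EL EI i 0 = K i 0 * EIs i 0.
  by rewrite /droop mulmxDl addrA hI dgE.
have eqQ j : QL j 0 = EL j 0 ^+ 2 * b j 0.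
  move/matrixP : hQ => /(_ j 0); rewrite mxE !coordE shunt_loadE => /eqP.
  by rewrite eq_sym subr_eq0 => /eqP.
have stable := exponential_stability htau hT mu0 coer EL0 EI0 b0 blow eqL eqI eqQ.
split; last exact: stable.
apply/closed_loopP; split => // [i|j].
  by rewrite eqI subrr mulr0 mxE mulr0.
by rewrite eqQ subrr mxE mulr0.
Qed.
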